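(* Let $(\Omega,\mathcal F,\mu,\{\mathcal F_n\}_{n\ge 0})$ be a filtered probability space, let $1<p<\infty$, let $w$ be a weight with $w\in A_p$, and let $S$ be a sparse operator with sparsity constant $K$. Then for every $f\in L^p(w)$, $$\|S|f|\|_{L^p(w)}\le C\,[w]_{A_p}^{\max\{1,\frac1{p-1}\}}\,\|f\|_{L^p(w)},$$ where the constant $C$ depends only on $p$ and $K$ (in particular it does not depend on $w$ or $f$).
   Context: Filtered probability space: $(\Omega,\mathcal F,\mu)$ is a complete probability space, $\{\mathcal F_n\}_{n\ge0}$ is an increasing sequence of sub-$\sigma$-algebras of $\mathcal F$, each $(\Omega,\mathcal F_n,\mu)$ is complete, and $\mathcal F$ is the $\sigma$-algebra generated by $\bigcup_n\mathcal F_n$. Weights: a weight $w$ is a positive random variable in $L^1(\mu)$; $\|f\|_{L^p(w)}=(\int_\Omega|f|^pw\,d\mu)^{1/p}$. With $\sigma=w^{-1/(p-1)}$ assumed to be in $L^1$ and $g_n=\mathbb E(g\mid\mathcal F_n)$, $[w]_{A_p}=\sup_{n\ge0}\|w_n\,(\sigma_n)^{p-1}\|_\infty$, and $w\in A_p$ means $[w]_{A_p}<\infty$. (Then $L^p(w)\subset L^1(\mu)$.) Stopping times: $\tau:\Omega\to\{0,1,2,\dots\}\cup\{\infty\}$ with $\{\tau=n\}\in\mathcal F_n$ for all $n$; $\mathcal F_\tau=\{F\in\mathcal F: F\cap\{\tau\le n\}\in\mathcal F_n\ \forall n\}$. Local space induced by a stopping time $\tau$: if $\mu(\tau<\infty)>0$,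 it is $(\widetilde\Omega,\widetilde{\mathcal F},\widetilde\mu,\{\widetilde{\mathcal F}_n\})$ with $\widetilde\Omega=\{\tau<\infty\}$, $\widetilde{\mathcal F}=\mathcal F|_{\{\tau<\infty\}}$, $\widetilde{\mathcal F}_n=\mathcal F_{\tau+n}|_{\{\tau<\infty\}}$, $\widetilde\mu=\mu|_{\{\tau<\infty\}}/\mu(\tau<\infty)$; any stopping time on this local space is called a locally filter-shifted stopping time relative to $\tau$. If $\mu(\tau<\infty)=0$, the local space is the space on which $\tau$ is defined, and $\tau$ itself is the only locally filter-shifted stopping time relative to $\tau$. Conditional sparsity: let $(\Omega^{(0)},\mathcal F^{(0)},\mu^{(0)},\{\mathcal F^{(0)}_n\})=(\Omega,\mathcal F,\mu,\{\mathcal F_n\})$, $\tau^{(0)}=0$, and for $i\ge0$ let $(\Omega^{(i+1)},\mathcal F^{(i+1)},\mu^{(i+1)},\{\mathcal F^{(i+1)}_n\})$ be the local space induced by the stopping time $\tau^{(i)}$ of $(\Omega^{(i)},\mathcal F^{(i)},\mu^{(i)},\{\mathcal F^{(i)}_n\})$, and $\tau^{(i+1)}$ a locally filter-shifted stopping time relative to $\tau^{(i)}$. Put $E_i=\{\tau^{(i)}<\infty\}$ and $S_i=E_i\setminus E_{i+1}$. The sequence $\{\tau^{(i)}\}_{i\ge0}$ is conditionally sparse if there is a constant $K\ge1$ (the sparsity constant) with $$\mathbf 1_{E_i}\le K\,\mathbb E\big(\mathbf 1_{S_i}\mid\mathcal F^{(i)}_{\tau^{(i)}}\big)\mathbf 1_{E_i}\qquad\text{for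 all } i\ge0 .$$ Conditional expectations given $\mathcal F^{(i)}_{\tau^{(i)}}$ are taken on $(\Omega^{(i)},\mathcal F^{(i)},\mu^{(i)})$, and their products with $\mathbf 1_{E_i}$ are extended by $0$ to $\Omega$. Sparse operator: an operator of the form $S|f|=\sum_{i=0}^\infty \mathbb E\big(|f|\mid\mathcal F^{(i)}_{\tau^{(i)}}\big)\mathbf 1_{E_i}$, $f\in L^1$, where $\{\tau^{(i)}\}_{i\ge0}$ is conditionally sparse. *)

(* Defs.v *)
From HB Require Import structures.
From mathcomp Require Import all_boot all_order all_algebra.
From mathcomp Require Import all_classical all_reals all_analysis.

Set Implicit Arguments.
Unset Strict Implicit.
Unset Printing Implicit Defensive.

Import Order.TTheory GRing.Theory Num.Theory.
Import numFieldNormedType.Exports.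

Local Open Scope classical_set_scope.
Local Open Scope ring_scope.

Record filtered_probability_space (d : measure_display) (T : measurableType d)
    (R : realType) (P : probability T R) (F : nat -> set (set T)) : Prop := {
  fps_complete : measure_is_complete P;
  fps_sigma : forall n, sigma_algebra [set: T] (F n);
  fps_sub : forall n, F n `<=` measurable;
  fps_incr : forall m n, (m <= n)%N -> F m `<=` F n;
  fps_completeF : forall n N A, F n N -> P N = 0%E -> A `<=` N -> F n A;
  fps_gen : measurable = <<s \bigcup_n F n >>
}.

(* A filtered measure space whose underlying set [fs_set] is a subset of the
   ambient type T; [fs_events] and [fs_filt n] consist of subsets of [fs_set].
   The measure is extended to sets of T by A |-> fs_measure (A `&` fs_set), so
   that integrals over the ambient measurable type make sense. *)
Record fspace (T : Type) (R : realType) := FSpace {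
  fs_set : set T;
  fs_events : set (set T);
  fs_measure : set T -> \bar R;
  fs_filt : nat -> set (set T)
}.

Definition whole_space (d : measure_display) (T : measurableType d)
    (R : realType) (P : probability T R) (F : nat -> set (set T)) :
    fspace T R :=
  FSpace [set: T] measurable P F.

Section stopping_times.
Context (T : Type) (R : realType).
Implicit Types (X : fspace T R) (t : T -> option nat).

(* A time on X is a map T -> option nat, with None standing for infinity; its
   values off [fs_set X] are irrelevant. *)

Definition stopping_time X t :=
  forall n, fs_filt X n [set x | fs_set X x /\ t x = Some n].

Definition stopped_set X t : set T := [set x | fs_set X x /\ t x <> None].

Definition stopped_by X t (n : nat) : set T :=
  [set x | fs_set X x /\ exists2 m, t x = Some m & (m <= n)%N].

Definition stopped_events X t : set (set T) :=
  [set A | fs_events X A /\ forall n, fs_filt X n (A `&` stopped_by X t n)].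

Definition shift_time t (n : nat) : T -> option nat :=
  fun x => omap (addn^~ n) (t x).

Definition trace (G : set (set T)) (E : set T) : set (set T) :=
  [set A `&` E | A in G].

Definition local_space X t : fspace T R :=
  let E := stopped_set X t in
  if (0 < fs_measure X E)%E then
    FSpace E (trace (fs_events X) E)
      (fun A => (fs_measure X (A `&` E) * ((fine (fs_measure X E))^-1)%:E)%E)
      (fun n => trace (stopped_events X (shift_time t n)) E)
  else X.

Definition locally_filter_shifted X t t' :=
  if (0 < fs_measure X (stopped_set X t))%E then
    stopping_time (local_space X t) t'
  else {in fs_set X, t' =1 t}.

End stopping_times.

Section conditional_expectation.
Context (d : measure_display) (T : measurableType d) (R : realType).

(* g is a version of the conditional expectation of f given the
   sigma-algebra G on [fs_set X]. *)
Definition is_condexp (X : fspace T R) (G : set (set T)) (f g : T -> R) :=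
  [/\ forall B : set R, measurable B -> G (fs_set X `&` g @^-1` B),
      (fs_measure X).-integrable (fs_set X) (EFin \o g) &
      forall A, G A ->
        (\int[fs_measure X]_(x in A) (g x)%:E =
         \int[fs_measure X]_(x in A) (f x)%:E)%E].

(* An arbitrary version; one exists whenever f is integrable and G is a
   sub-sigma-algebra of [fs_events X], and it is unique up to a null set. *)
Definition condexp (X : fspace T R) (G : set (set T)) (f : T -> R) : T -> R :=
  xget (cst 0) [set g | is_condexp X G f g].

End conditional_expectation.

Section weights.
Context (d : measure_display) (T : measurableType d) (R : realType).
Variables (P : probability T R) (F : nat -> set (set T)).

Definition weight (w : T -> R) :=
  P.-integrable [set: T] (EFin \o w) /\ {ae P, forall x, 0 < w x}.

Definition wnorm (p : R) (w : T -> R) (f : T -> \bar R) : \bar R :=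
  ((\int[P]_x (`|f x| `^ p * (w x)%:E)) `^ p^-1)%E.

Definition in_Lpw (p : R) (w : T -> R) (f : T -> R) :=
  measurable_fun [set: T] f /\ (wnorm p w (EFin \o f) < +oo)%E.

Definition dual_weight (p : R) (w : T -> R) : T -> R :=
  fun x => w x `^ (- (p - 1)^-1).

Definition cond (n : nat) (g : T -> R) : T -> R :=
  condexp (whole_space P F) (F n) g.

Definition Ap_const (p : R) (w : T -> R) : \bar R :=
  ereal_sup (range (fun n => Lnorm P +oo%E
    (fun x => (cond n w x * cond n (dual_weight p w) x `^ (p - 1))%:E))).

Definition in_Ap (p : R) (w : T -> R) :=
  P.-integrable [set: T] (EFin \o dual_weight p w) /\
  (Ap_const p w < +oo)%E.

End weights.

Section sparse.
Context (d : measure_display) (T : measurableType d) (R : realType).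
Variables (P : probability T R) (F : nat -> set (set T)).
Variable tau : nat -> T -> option nat.

Fixpoint iter_space (i : nat) : fspace T R :=
  if i is j.+1 then local_space (iter_space j) (tau j) else whole_space P F.

Definition shifted_sequence :=
  (forall x, tau 0%N x = Some 0%N) /\
  forall i, locally_filter_shifted (iter_space i) (tau i) (tau i.+1).

Definition Eset (i : nat) : set T := stopped_set (iter_space i) (tau i).

Definition Sset (i : nat) : set T := Eset i `\` Eset i.+1.

(* E(f | F^(i)_(tau i)) 1_(E i), computed on the i-th local space. *)
Definition local_avg (i : nat) (f : T -> R) : T -> R :=
  fun x => condexp (iter_space i) (stopped_events (iter_space i) (tau i)) f x
           * \1_(Eset i) x.

Definition conditionally_sparse (K : R) :=
  [/\ shifted_sequence, 1 <= K &
      forall i, {ae P, forall x,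
        \1_(Eset i) x <= K * local_avg i (\1_(Sset i)) x}].

Definition sparse_op (f : T -> R) : T -> \bar R :=
  fun x => (\sum_(0 <= i <oo) (local_avg i (fun y => `|f y|%R) x)%:E)%E.

End sparse.

(* Main.v *)
Require Import Defs.
From HB Require Import structures.
From mathcomp Require Import all_boot all_order all_algebra.
From mathcomp Require Import all_classical all_reals all_analysis.
From mathcomp Require Import measurable_realfun ess_sup_inf.
From mathcomp Require Import ring lra zify.
Import Order.TTheory GRing.Theory Num.Theory.
Import numFieldNormedType.Exports.
Local Open Scope classical_set_scope.
Local Open Scope ring_scope.

Set Implicit Arguments.
Unset Strict Implicit.
Unset Printing Implicit Defensive.

(** Adding up the successive local stopping times gives times [t_i] of the
    original filtration; with [G_i] the sigma-algebra of [t_i], everything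
    happens along the filtration [G_i] and the decreasing sets
    [E_i = {t_i < oo}].  Write [s = w^(-1/(p-1))], and [a_i], [w_i], [s_i] for
    the averages of [|f|], [w], [s] given [G_i].

    Let [A_n = \sum_(i < n) a_i 1_(E_i)].  By convexity
    [A_(i+1)^p - A_i^p <= p a_i A_(i+1)^(p-1)], so averaging [w] bounds
    [\int A_n^p w] by [p \sum_i \int_(E_i) m_i A_(i+1)^(p-1) s_i w_i], where
    [m_i = a_i / s_i].  Sparsity and Markov's inequality bound the integral
    over [E_i] by [2K] times the integral over the part of [S_i] where
    [w <= 4K w_i] and [s <= 4K s_i]; there the [A_p] condition gives
    [w_i s_i <= C [w]^(max(1, 1/(p-1))) w^(1-1/p) s^(1/p)].  The sets [S_i] are
    disjoint, hence
    [\int A_n^p w <= C' \int (M_n s^(1/p)) (A_n w^(1/p))^(p-1)] with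
    [M_n = max_(i < n) m_i 1_(E_i)].  Young's inequality absorbs [A_n], and
    Doob's inequality for the measure [s dP], proved by the same telescoping
    and absorption, bounds [\int M_n^p s] by [(p/(p-1))^p \int |f|^p w].
    Absorption needs finite integrals, so [E_i] is first cut down to the part
    where [A_(i+1)] and the [m_j], [j <= i], are bounded by a constant. *)

(** * Inequalities for real powers *)

(** Young's inequality for the conjugate exponents p and p/(p-1), applied to x and z^(p-1). Both
    tangent inequalities below and both absorptions rest on it. *)
Lemma young_powR (R : realType) (p x z : R) : 1 < p -> 0 <= x -> 0 <= z ->
  x * z `^ (p - 1) <= x `^ p / p + (1 - p^-1) * z `^ p.
Proof.
move=> p1 x0 z0; have p0 : 0 < p by lra.
have q0 : 0 < p - 1 by lra.
have := @conjugate_powR R x (z `^ (p - 1)) p (p / (p - 1)) x0 (powR_ge0 _ _) p0.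
rewrite -powRrM (_ : (p - 1) * (p / (p - 1)) = p); last by field; rewrite gt_eqF.
rewrite (_ : (p / (p - 1))^-1 = 1 - p^-1); last by field; rewrite !gt_eqF.
rewrite [z `^ p * _]mulrC; apply; first by rewrite divr_gt0.
by rewrite addrC subrK.
Qed.

(** The tangent to t^p at z, evaluated at x. It telescopes the powers of the partial sums. *)
Lemma powR_increment_le (R : realType) (p x z : R) : 1 < p -> 0 <= x -> 0 <= z ->
  z `^ p - x `^ p <= p * ((z - x) * z `^ (p - 1)).
Proof.
move=> p1 x0 z0; have p0 : 0 < p by lra.
have := young_powR p1 x0 z0.
rewrite [(z - x) * _]mulrBl mulr_powRB1//.
set a := x * _; set b := x `^ p; set c := z `^ p => H.
rewrite -subr_ge0 (_ : _ - _ = p * (b / p + (1 - p^-1) * c - a)).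
  by apply: mulr_ge0; [exact: ltW|rewrite subr_ge0].
by field; rewrite !gt_eqF.
Qed.

(** The same tangent inequality for the exponent p/(p-1), at the points x^(p-1) and y^(p-1).
    Increments of the power p-1 are what Doob's argument sums by parts. *)
Lemma powR_increment_conj_le (R : realType) (p x y : R) : 1 < p -> 0 <= x -> 0 <= y ->
  y `^ p - x `^ p <= p / (p - 1) * ((y `^ (p - 1) - x `^ (p - 1)) * y).
Proof.
move=> p1 x0 y0; have p0 : 0 < p by lra.
have q0 : 0 < p - 1 by lra.
have := young_powR p1 y0 x0.
rewrite [(_ - _) * y]mulrBl [y `^ (p - 1) * y]mulrC mulr_powRB1// [x `^ _ * y]mulrC.
set a := y * _; set b := y `^ p; set c := x `^ p => H.
rewrite -subr_ge0 (_ : _ - _ = p / (p - 1) * (b / p + (1 - p^-1) * c - a)).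
  by apply: mulr_ge0; [apply: divr_ge0; exact: ltW|rewrite subr_ge0].
by field; rewrite !gt_eqF.
Qed.

(* Taking logarithms, the claim is linear in [ln u], [ln s], [ln w]. *)
Lemma Ap_product_le (R : realType) (p Q L u s w : R) : 1 < p -> 1 <= L ->
  0 < u -> 0 < s -> 0 < w -> u * s `^ (p - 1) <= Q -> w <= L * u ->
  w `^ (- (p - 1)^-1) <= L * s ->
  u * s <= Q `^ (Num.max 1 (p - 1)^-1) * L `^ (p + (p - 1)^-1)
           * (w `^ (1 - p^-1) * (w `^ (- (p - 1)^-1)) `^ p^-1).
Proof.
move=> p1 L1 u0 s0 w0 uQ wu ws.
have p0 : 0 < p by lra.
have q0 : 0 < p - 1 by lra.
have L0 : 0 < L by lra.
have Q0 : 0 < Q by apply: lt_le_trans uQ; rewrite mulr_gt0 ?powR_gt0.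
have v0 : 0 < w `^ (- (p - 1)^-1) by rewrite powR_gt0.
rewrite -ler_ln ?posrE ?mulr_gt0 ?powR_gt0//.
have le_ln (a b : R) : 0 < a -> a <= b -> ln a <= ln b.
  by move=> a0 ab; rewrite ler_ln ?posrE// (lt_le_trans a0).
move/(le_ln _ _ (mulr_gt0 u0 (powR_gt0 _ s0))) : uQ.
move/(le_ln _ _ w0) : wu; move/(le_ln _ _ v0) : ws.
rewrite !lnM ?posrE ?mulr_gt0 ?powR_gt0// !ln_powR.
have : 0 <= ln L by rewrite ln_ge0.
move: (ln u) (ln s) (ln w) (ln Q) (ln L) => U S W q l l0 WS WU Uq.
set r := (p - 1)^-1 in WS *.
have r0 : 0 < r by rewrite invr_gt0.
have rp : r * (p - 1) = 1 by rewrite mulVf ?gt_eqF.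
have -> : (1 - p^-1) * W + p^-1 * (- r * W) = W - r * W.
  have -> : p = 1 + r^-1 by rewrite invrK; lra.
  by field; rewrite !gt_eqF //; lra.
(* If p >= 2, write U + S as U + (p-1)S minus (p-2)S and control -(p-2)S by [WS]. If p < 2, multiply
   [Uq] by r, which gives rU + S, and control -(r-1)U by [WU]. This split is the source of the
   exponent max(1, r). *)
have [p2|p2] := leP 2 p.
  have r1 : r <= 1 by rewrite invf_le1//; lra.
  rewrite max_l// mul1r.
  have E : r * W * (p - 1) = W by rewrite mulrAC rp mul1r.
  have : (- r * W - l - S) * (p - 2) <= 0 by apply: mulr_le0_ge0; lra.
  have : 0 <= r * l by rewrite mulr_ge0// ltW.
  move: E Uq l0; rewrite !(mulrBr, mulrBl, mulrDl, mulrDr); lra.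
have r1 : 1 <= r by rewrite -(ler_pM2r q0) mul1r rp; lra.
rewrite max_r//.
have E : r * (U + (p - 1) * S) <= r * q by rewrite ler_pM2l.
have E2 : r * ((p - 1) * S) = S by rewrite mulrA rp mul1r.
have : (W - l - U) * (r - 1) <= 0 by apply: mulr_le0_ge0; lra.
have : 0 <= p * l by rewrite mulr_ge0// ltW.
move: E E2 Uq l0; rewrite !(mulrBr, mulrBl, mulrDl, mulrDr); lra.
Qed.

(** * Sub-sigma-algebras *)

Section sub_sigma_algebra.
Context (d : measure_display) (T : measurableType d) (R : realType).
Implicit Types (G : set (set T)) (h : T -> R).

Definition sub_salgebra G :=
  sigma_algebra [set: T] G /\ G `<=` @measurable d T.

(** The source carries the sigma-algebra generated by [G], so the usual closure properties of
    measurable functions apply; by [salgebra_measurableE] it is [G] itself when [G] is a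
    sigma-algebra. *)
Definition gmeasurable_fun G h :=
  @measurable_fun _ _ (g_sigma_algebraType G) R setT h.

Lemma salgebra_measurableE G :
  sub_salgebra G -> @measurable _ (g_sigma_algebraType G) = G.
Proof. by case=> sG _; rewrite /measurable /= (sigma_algebra_id sG). Qed.

Lemma salgebra0 G : sub_salgebra G -> G set0.
Proof. by move=> /salgebra_measurableE <-; exact: measurable0. Qed.

Lemma salgebraT G : sub_salgebra G -> G setT.
Proof. by move=> /salgebra_measurableE <-; exact: measurableT. Qed.

Lemma salgebraC G A : sub_salgebra G -> G A -> G (~` A).
Proof. by move=> /salgebra_measurableE <-; exact: measurableC. Qed.

Lemma salgebraI G A B : sub_salgebra G -> G A -> G B -> G (A `&` B).
Proof. by move=> /salgebra_measurableE <-; exact: measurableI. Qed.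

Lemma salgebraU G A B : sub_salgebra G -> G A -> G B -> G (A `|` B).
Proof. by move=> /salgebra_measurableE <-; exact: measurableU. Qed.

Lemma salgebra_bigcup G (A : nat -> set T) (D : set nat) : sub_salgebra G ->
  (forall n, D n -> G (A n)) -> G (\bigcup_(n in D) A n).
Proof. by move=> /salgebra_measurableE <-; exact: bigcup_measurable. Qed.

Lemma salgebra_bigcap G (A : nat -> set T) (D : set nat) : sub_salgebra G ->
  (forall n, D n -> G (A n)) -> G (\bigcap_(n in D) A n).
Proof. by move=> /salgebra_measurableE <-; exact: bigcap_measurableType. Qed.

Lemma gmeasurable_funP G h : sub_salgebra G ->
  gmeasurable_fun G h <-> forall B, measurable B -> G (h @^-1` B).
Proof.
move=> [sG _]; split => [mh B mB|hG _ B mB].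
  have := mh measurableT B mB; rewrite setTI.
  by rewrite /measurable /= (sigma_algebra_id sG).
by rewrite setTI /measurable /= (sigma_algebra_id sG); exact: hG.
Qed.

Lemma gmeasurable_fun_measurable G h : sub_salgebra G ->
  gmeasurable_fun G h -> measurable_fun setT h.
Proof.
move=> sG /(gmeasurable_funP _ sG) hG _ B mB; rewrite setTI.
by apply: (sG.2); exact: hG.
Qed.

Lemma sub_gmeasurable_fun G G' h : sub_salgebra G -> sub_salgebra G' ->
  G `<=` G' -> gmeasurable_fun G h -> gmeasurable_fun G' h.
Proof.
move=> sG sG' GG' /(gmeasurable_funP _ sG) hG; apply/(gmeasurable_funP _ sG').
by move=> B mB; exact/GG'/hG.
Qed.

Lemma gmeasurable_indic G A : sub_salgebra G -> G A ->
  gmeasurable_fun G (\1_A : T -> R).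
Proof.
move=> [sG _] GA; apply: measurable_indic.
by rewrite /measurable /= (sigma_algebra_id sG).
Qed.

Lemma gmeasurable_powR G h q : gmeasurable_fun G h ->
  gmeasurable_fun G (fun x => h x `^ q).
Proof.
move=> mh; exact: (@measurableT_comp _ _ _ (g_sigma_algebraType G) R R
  (@powR R ^~ q) setT h (measurable_powR q) mh).
Qed.

End sub_sigma_algebra.

(** * Integral comparisons against functions measurable for a sub-sigma-algebra *)

Section comparison.
Context (d : measure_display) (T : measurableType d) (R : realType).
Variables (mu : {measure set T -> \bar R}) (G : set (set T)).
Hypothesis sG : sub_salgebra G.
Import HBNNSimple.
Local Open Scope ereal_scope.

Let integral_nnsfun (h : {nnsfun g_sigma_algebraType G >-> R}) (u : T -> R) :
  measurable_fun setT u -> (forall x, (0 <= u x)%R) ->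
  \int[mu]_x (h x * u x)%:E =
  \sum_(y \in range h) (y%:E * \int[mu]_(x in h @^-1` [set y]) (u x)%:E).
Proof.
move=> mu_ u0.
have Gpre y : G (h @^-1` [set y]).
  have mh : gmeasurable_fun G h by exact: measurable_funP.
  exact: (proj1 (gmeasurable_funP _ sG) mh _ (measurable_set1 y)).
have mpre y : @measurable d T (h @^-1` [set y]) by exact: sG.2.
transitivity (\int[mu]_x (\sum_(y \in range h)
    (y * \1_(h @^-1` [set y]) x * u x)%:E)).
  apply: eq_integral => x _; rewrite [in LHS]fimfunE fsumEFin//.
  by rewrite -mulr_fsuml.
rewrite ge0_integral_fsum//; last 2 first.
- move=> y; apply/measurable_EFinP; apply: measurable_funM => //.
  by apply: measurable_funM => //; exact: measurable_indic.
- move=> y x _; rewrite lee_fin mulr_ge0//.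
  have := @nnfun_muleindic_ge0 _ _ _ h y x; by rewrite -EFinM lee_fin.
apply: eq_fsbigr => y; rewrite inE => -[t _ <-].
rewrite -ge0_integralZl_EFin//; last 2 first.
- by move=> x _; rewrite lee_fin.
- by apply/measurable_EFinP; exact: measurable_funTS.
rewrite [RHS]integral_mkcond; apply: eq_integral => x _.
rewrite patchE /= indicE; case: ifPn => _; first by rewrite mulr1 EFinM.
by rewrite mulr0 mul0r.
Qed.

(** Level sets of a [G]-measurable simple function lie in [G], so the hypothesis on sets gives the
    claim for simple [h]; monotone convergence does the rest. This plays the part of pulling a known
    factor out of a conditional expectation, in one-sided form. *)
Lemma le_integral_gmeasurable (u v h : T -> R) :
  measurable_fun setT u -> measurable_fun setT v -> gmeasurable_fun G h ->
  (forall x, (0 <= u x)%R) -> (forall x, (0 <= v x)%R) ->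
  (forall x, (0 <= h x)%R) ->
  (forall A, G A -> \int[mu]_(x in A) (u x)%:E <= \int[mu]_(x in A) (v x)%:E) ->
  \int[mu]_x (h x * u x)%:E <= \int[mu]_x (h x * v x)%:E.
Proof.
move=> mu_ mv mh u0 v0 h0 uv.
have mEh : @measurable_fun _ _ (g_sigma_algebraType G) _ setT (EFin \o h).
  exact/measurable_EFinP.
pose h_ := nnsfun_approx measurableT mEh.
have mh_ n : measurable_fun [set: T] (h_ n : T -> R).
  apply: (gmeasurable_fun_measurable sG); exact: measurable_funP.
have limE (g : T -> R) : measurable_fun setT g -> (forall x, (0 <= g x)%R) ->
    (\int[mu]_x (h_ n x * g x)%:E @[n --> \oo] --> \int[mu]_x (h x * g x)%:E).
  move=> mg g0.
  have -> : \int[mu]_x (h x * g x)%:E =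
      \int[mu]_x (limn (fun n => (h_ n x * g x)%:E)).
    apply: eq_integral => x _; apply/esym/cvg_lim => //.
    have hx : (EFin \o h_^~ x) n @[n --> \oo] --> (h x)%:E.
      by apply: (@cvg_nnsfun_approx _ _ _ _ measurableT _ mEh) => // y _; rewrite lee_fin.
    exact: (@cvgeZr _ _ _ _ _ (g x)%:E _ hx).
  apply: cvg_monotone_convergence => //.
  - by move=> n; apply/measurable_EFinP; exact: measurable_funM.
  - by move=> n x _; rewrite lee_fin mulr_ge0.
  - move=> x _ m n mn; rewrite lee_fin ler_wpM2r//.
    by have /lefP := nd_nnsfun_approx measurableT mEh mn; exact.
apply: (@lee_cvg_to _ _ _ _ _ _ _ _ (limE u mu_ u0) (limE v mv v0)).
near=> n; rewrite !integral_nnsfun//.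
apply: lee_fsum => // y [t _ <-]; apply: lee_pmul => //.
- by rewrite lee_fin.
- by apply: integral_ge0 => x _; rewrite lee_fin.
- have mhn : gmeasurable_fun G (h_ n) by exact: measurable_funP.
  exact/uv/(proj1 (gmeasurable_funP _ sG) mhn _ (measurable_set1 _)).
Unshelve. all: by end_near. Qed.

End comparison.

(** * Existence of conditional expectations *)

Section condexp_existence.
Context (d : measure_display) (T : measurableType d) (R : realType).
Variables (P : probability T R) (G : set (set T)).
Hypothesis sG : sub_salgebra G.
Local Notation TG := (g_sigma_algebraType G).

Let measurable_sub (A : set T) : @measurable _ TG A -> @measurable d T A.
Proof. by move=> mA; apply: sG.2; rewrite -(sigma_algebra_id sG.1). Qed.

Let measurable_id_sub : @measurable_fun _ _ T TG setT id.
Proof. by move=> _ B mB; rewrite setTI preimage_id; exact: measurable_sub. Qed.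

(* The unused argument keeps the proof on which the measure and charge
   instances depend. *)
Definition restricted_measure of sub_salgebra G : set TG -> \bar R := P.

Let restricted0 : restricted_measure sG set0 = 0%E.
Proof. exact: measure0. Qed.

Let restricted_ge0 A : (0 <= restricted_measure sG A)%E.
Proof. exact: measure_ge0. Qed.

Let restricted_sigma_additive : semi_sigma_additive (restricted_measure sG).
Proof.
move=> F mF tF mUF; apply: measure_semi_sigma_additive => //.
- by move=> n; exact: measurable_sub.
- exact: measurable_sub.
Qed.

HB.instance Definition _ := isMeasure.Build _ _ _ (restricted_measure sG)
  restricted0 restricted_ge0 restricted_sigma_additive.

Let restricted_finite : fin_num_fun (restricted_measure sG).
Proof.
by move=> A mA; apply: fin_num_measure; exact: measurable_sub.
Qed.

HB.instance Definition _ :=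
  Measure_isFinite.Build _ _ _ (restricted_measure sG) restricted_finite.

Section charge.
Variable f : T -> R.
Hypothesis intf : P.-integrable setT (EFin \o f).

Definition restricted_charge of sub_salgebra G : set TG -> \bar R :=
  induced_charge intf.

Let charge0 : restricted_charge sG set0 = 0%E.
Proof. exact: charge0. Qed.

Let charge_finite : fin_num_fun (restricted_charge sG).
Proof.
by move=> A mA; apply: fin_num_measure; exact: measurable_sub.
Qed.

Let charge_sigma_additive : semi_sigma_additive (restricted_charge sG).
Proof.
move=> F mF tF mUF; apply: charge_semi_sigma_additive => //.
- by move=> n; exact: measurable_sub.
- exact: measurable_sub.
Qed.

HB.instance Definition _ := isCharge.Build _ _ _ (restricted_charge sG)
  charge0 charge_finite charge_sigma_additive.

(** The version is the Radon-Nikodym derivative of the charge f dP with respect to P, both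
    restricted to [G]. *)
Lemma exists_conditional_expectation : exists g : T -> R,
  [/\ gmeasurable_fun G g, P.-integrable setT (EFin \o g) &
      forall A, G A ->
        (\int[P]_(x in A) (g x)%:E = \int[P]_(x in A) (f x)%:E)%E].
Proof.
have dom : restricted_charge sG `<< restricted_measure sG.
  apply/null_content_dominatesP => A mA PA0.
  apply: null_set_integral => //; first exact: measurable_sub.
  apply: measurable_funTS; exact: measurable_int intf.
pose h := Radon_Nikodym (restricted_charge sG) (restricted_measure sG).
have inth : (restricted_measure sG).-integrable setT h.
  exact: Radon_Nikodym_integrable.
have hE : EFin \o (fine \o h) = h.
  by apply/funext => x /=; rewrite fineK//; exact: Radon_Nikodym_fin_num.
have mh : measurable_fun setT h by exact: measurable_int inth.
(* The restriction of P is its image under the identity from [T] to [TG], so the change of variables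
   formula carries integrals from one type to the other. *)
have pushE : restricted_measure sG = pushforward P (id : T -> TG) by [].
have mhT : @measurable_fun _ _ T _ setT h.
  move=> _ B mB; rewrite setTI; apply: measurable_sub.
  by have := mh measurableT B mB; rewrite setTI.
have inthP : P.-integrable setT h.
  apply/integrableP; split => //.
  case/integrableP : inth => _; apply: le_lt_trans.
  rewrite pushE (@ge0_integral_pushforward _ _ _ _ _ _ measurable_id_sub)//.
  exact: measurableT_comp.
exists (fine \o h); split.
- apply: measurableT_comp => //.
- by rewrite hE.
- move=> A GA.
  have mA : @measurable _ TG A by rewrite /measurable /= (sigma_algebra_id sG.1).
  have : (restricted_charge sG A = \int[restricted_measure sG]_(x in A) h x)%E.
    exact: Radon_Nikodym_integral.
  rewrite pushE (@integral_pushforward _ _ _ _ _ _ measurable_id_sub)//.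
    rewrite preimage_id => hA; rewrite -[RHS]/(restricted_charge sG A) hA.
    apply: eq_integral => x _.
    by rewrite -[in RHS]hE.
  by apply: (integrableS measurableT) => //; exact: measurable_sub.
Qed.

End charge.
End condexp_existence.

(** [condexp] is a choice with default [cst 0]; as a version exists for integrable [f], the chosen
    function is one. *)
Lemma cond_condexp (d : measure_display) (T : measurableType d) (R : realType)
  (P : probability T R) (F : nat -> set (set T)) n (f : T -> R) :
  sub_salgebra (F n) -> P.-integrable setT (EFin \o f) ->
  [/\ gmeasurable_fun (F n) (cond P F n f),
      P.-integrable setT (EFin \o cond P F n f) &
      forall A, F n A ->
        (\int[P]_(x in A) (cond P F n f x)%:E = \int[P]_(x in A) (f x)%:E)%E].
Proof.
move=> sF intf; have [g [mg intg gE]] := exists_conditional_expectation sF intf.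
have : is_condexp (whole_space P F) (F n) f (cond P F n f).
  apply: (@xgetPex _ (cst 0) [set g | is_condexp (whole_space P F) (F n) f g]).
  exists g; split => //= B mB; rewrite setTI.
  exact: (proj1 (gmeasurable_funP _ sF) mg).
move=> [m1 i1 e1]; split => //; apply/(gmeasurable_funP _ sF) => B mB.
by have := m1 B mB; rewrite /= setTI.
Qed.

(** * Integrals of nonnegative real functions *)

Section integral_real.
Context (d : measure_display) (T : measurableType d) (R : realType).
Variable mu : {measure set T -> \bar R}.
Implicit Types g h : T -> R.
Local Open Scope ereal_scope.

Lemma le_integral_EFin g h : measurable_fun setT g -> measurable_fun setT h ->
  (forall x, (0 <= g x)%R) -> (forall x, (g x <= h x)%R) ->
  \int[mu]_x (g x)%:E <= \int[mu]_x (h x)%:E.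
Proof.
move=> mg mh g0 gh; apply: ge0_le_integral => //.
- by move=> x _; rewrite lee_fin.
- exact/measurable_EFinP.
- exact/measurable_EFinP.
- by move=> x _; rewrite lee_fin.
Qed.

Lemma integral_addEFin g h : measurable_fun setT g -> measurable_fun setT h ->
  (forall x, (0 <= g x)%R) -> (forall x, (0 <= h x)%R) ->
  \int[mu]_x (g x + h x)%:E = \int[mu]_x (g x)%:E + \int[mu]_x (h x)%:E.
Proof.
move=> mg mh g0 h0; under eq_integral do rewrite EFinD.
rewrite ge0_integralD//.
- by move=> x _; rewrite lee_fin.
- exact/measurable_EFinP.
- by move=> x _; rewrite lee_fin.
- exact/measurable_EFinP.
Qed.

Lemma integral_scaleEFin (c : R) g : measurable_fun setT g ->
  (forall x, (0 <= g x)%R) -> (0 <= c)%R ->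
  \int[mu]_x (c * g x)%:E = c%:E * \int[mu]_x (g x)%:E.
Proof.
move=> mg g0 c0; under eq_integral do rewrite EFinM.
rewrite ge0_integralZl_EFin//.
- by move=> x _; rewrite lee_fin.
- exact/measurable_EFinP.
Qed.

Lemma le_integral_comb (b c : R) (g1 g2 h : T -> R) :
  measurable_fun setT g1 -> measurable_fun setT g2 -> measurable_fun setT h ->
  (forall x, (0 <= g1 x)%R) -> (forall x, (0 <= g2 x)%R) ->
  (forall x, (0 <= h x)%R) -> (0 <= b)%R -> (0 <= c)%R ->
  (forall x, (h x <= b * g1 x + c * g2 x)%R) ->
  \int[mu]_x (h x)%:E <=
    b%:E * \int[mu]_x (g1 x)%:E + c%:E * \int[mu]_x (g2 x)%:E.
Proof.
move=> mg1 mg2 mh g10 g20 h0 b0 c0 hg.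
have mb : measurable_fun setT (fun x => b * g1 x)%R by exact: measurable_funM.
have mc : measurable_fun setT (fun x => c * g2 x)%R by exact: measurable_funM.
have bg0 x : (0 <= b * g1 x)%R by rewrite mulr_ge0.
have cg0 x : (0 <= c * g2 x)%R by rewrite mulr_ge0.
rewrite -(integral_scaleEFin mg1 g10 b0) -(integral_scaleEFin mg2 g20 c0).
rewrite -(integral_addEFin mb mc bg0 cg0).
by apply: le_integral_EFin => //; exact: measurable_funD.
Qed.

Lemma integral_mul_indicEFin (A : set T) g :
  \int[mu]_x (g x * \1_A x)%:E = \int[mu]_(x in A) (g x)%:E.
Proof.
rewrite [RHS]integral_mkcond; apply: eq_integral => x _.
rewrite patchE indicE; case: ifP => _; first by rewrite mulr1.
by rewrite mulr0.
Qed.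

(** The averages are controlled only on a set [D] of [G]. Since an indicator is idempotent, [\1_D]
    can be attached to each of [u], [v] and [h], which makes them nonnegative everywhere and reduces
    the claim to the global comparison. *)
Lemma le_integral_gmeasurable_in (G : set (set T)) (D : set T) (u v h : T -> R) :
  sub_salgebra G -> G D ->
  measurable_fun setT u -> measurable_fun setT v -> gmeasurable_fun G h ->
  (forall x, D x -> (0 <= u x)%R) -> (forall x, D x -> (0 <= v x)%R) ->
  (forall x, D x -> (0 <= h x)%R) ->
  (forall A, G A -> A `<=` D ->
    \int[mu]_(x in A) (u x)%:E <= \int[mu]_(x in A) (v x)%:E) ->
  \int[mu]_x (h x * \1_D x * u x)%:E <= \int[mu]_x (h x * \1_D x * v x)%:E.
Proof.
move=> sG GD mu_ mv mh u0 v0 h0 uv.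
have ind_ge0 (g : T -> R) : (forall x, D x -> (0 <= g x)%R) ->
    forall x, (0 <= g x * \1_D x)%R.
  move=> g0 x; rewrite indicE; have [xD|xD] := boolP (x \in D).
    by rewrite mulr1; apply: g0; rewrite inE in xD.
  by rewrite mulr0.
have idem (g : T -> R) x : (h x * \1_D x * g x = h x * \1_D x * (g x * \1_D x))%R.
  by rewrite indicE; case: (x \in D); rewrite ?mulr1// !mulr0 !mul0r.
under eq_integral do rewrite idem.
under [leRHS]eq_integral do rewrite idem.
have mD : measurable D by exact: sG.2.
have mDi : measurable_fun setT (\1_D : T -> R) by exact: measurable_indic.
apply: (le_integral_gmeasurable (G := G) sG) => //.
- exact: measurable_funM.
- exact: measurable_funM.
- by apply: measurable_funM => //; exact: gmeasurable_indic.
- exact: ind_ge0.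
- exact: ind_ge0.
- exact: ind_ge0.
- move=> A GA.
  have E (g : T -> R) : \int[mu]_(x in A) (g x * \1_D x)%:E =
      \int[mu]_(x in A `&` D) (g x)%:E.
    rewrite -(integral_mul_indicEFin A (fun x => g x * \1_D x)%R).
    rewrite -(integral_mul_indicEFin (A `&` D) g).
    by apply: eq_integral => x _; rewrite indicI /= -mulrA [(\1_D x * _)%R]mulrC.
  rewrite !E; apply: uv; last by move=> x [].
  exact: salgebraI.
Qed.

End integral_real.

(** * The estimate for truncated averages *)

(** The term (1 - 1/p) X is subtracted from both sides, which is legitimate because X is finite. *)
Lemma young_absorb (R : realType) (p c : R) (X Y : \bar R) :
  1 < p -> 0 <= c -> (0 <= X)%E -> (X < +oo)%E -> (0 <= Y)%E ->
  (X <= (c / p)%:E * Y + (1 - p^-1)%:E * X)%E -> (X <= c%:E * Y)%E.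
Proof.
move=> p1 c0; have p0 : 0 < p by lra.
move: X Y => [x||]// [y||]//.
- rewrite !lee_fin => x0 _ y0 H.
  have : x * p^-1 <= c * y * p^-1 by move: H; rewrite mulrBl mul1r mulrAC; lra.
  by rewrite ler_pM2r ?invr_gt0.
(* With Y infinite and c = 0 the product c Y is 0 by convention; the hypothesis then reads x <= (1 -
   1/p) x and forces x <= 0. *)
- rewrite lee_fin => x0 _ _; have [->|c_gt0] := eqVneq c 0.
    rewrite !mul0r !mul0e add0e !lee_fin mulrBl mul1r => H.
    have : 0 < p^-1 by rewrite invr_gt0.
    nra.
  by move=> _; rewrite gt0_muley ?leey// lte_fin lt_neqAle eq_sym c_gt0.
Qed.

(** An abstract setting: of each average it keeps its measurability, its sign on [D i], and one
    integral inequality over the sets of [G i] inside [D i], in the direction used for upper bounds.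
    [D i] stands for the truncated [E i]. *)
Section bounded_sparse_estimate.
Context (d : measure_display) (T : measurableType d) (R : realType).
Variable P : probability T R.
Variables (p K Q k : R) (G : nat -> set (set T)) (D S : nat -> set T).
Variables (w f : T -> R) (wi si a : nat -> T -> R).

Local Notation s := (fun x => w x `^ (- (p - 1)^-1)).

Hypotheses (p1 : 1 < p) (K1 : 1 <= K) (k0 : 0 <= k).
Hypothesis sG : forall i, sub_salgebra (G i).
Hypothesis Gincr : forall i, G i `<=` G i.+1.
Hypothesis GD : forall i, G i (D i).
Hypothesis mS : forall i, measurable (S i).
Hypothesis SD : forall i j x, (i < j)%N -> S i x -> ~ D j x.
Hypothesis sparseS : forall i A, G i A -> A `<=` D i ->
  (P A <= K%:E * P (A `&` S i))%E.
Hypotheses (mw : measurable_fun setT w) (w0 : forall x, 0 < w x).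
Hypotheses (intw : (\int[P]_x (w x)%:E < +oo)%E)
           (ints : (\int[P]_x (s x)%:E < +oo)%E).
Hypotheses (mf : measurable_fun setT f) (f0 : forall x, 0 <= f x).
Hypotheses (mwi : forall i, gmeasurable_fun (G i) (wi i))
           (msi : forall i, gmeasurable_fun (G i) (si i))
           (ma : forall i, gmeasurable_fun (G i) (a i)).
Hypotheses (wi0 : forall i x, D i x -> 0 < wi i x)
           (si0 : forall i x, D i x -> 0 < si i x)
           (a0 : forall i x, D i x -> 0 <= a i x).
Hypothesis ApQ : forall i x, D i x -> wi i x * si i x `^ (p - 1) <= Q.
Hypothesis wi_avg : forall i A, G i A -> A `<=` D i ->
  (\int[P]_(x in A) (w x)%:E <= \int[P]_(x in A) (wi i x)%:E)%E.
Hypothesis si_avg : forall i A, G i A -> A `<=` D i ->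
  (\int[P]_(x in A) (s x)%:E <= \int[P]_(x in A) (si i x)%:E)%E.
Hypothesis a_avg : forall i A, G i A -> A `<=` D i ->
  (\int[P]_(x in A) (a i x)%:E <= \int[P]_(x in A) (f x)%:E)%E.

Definition stopped_avg i x := a i x * \1_(D i) x.
(** Writing the inverse of [si] as a real power makes it nonnegative everywhere; on [D i], where
    [si] is positive, it is the true inverse. *)
Definition weighted_avg i x := stopped_avg i x * si i x `^ (-1).
Definition partial_sparse n x := \sum_(i < n) stopped_avg i x.
Fixpoint partial_max n x :=
  if n is m.+1 then Num.max (partial_max m x) (weighted_avg m x) else 0.

Local Notation al := stopped_avg.
Local Notation m := weighted_avg.
Local Notation A := partial_sparse.
Local Notation M := partial_max.

Hypothesis A_bound : forall i x, D i x -> A i.+1 x <= k.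
Hypothesis m_bound : forall i x, D i x -> m i x <= k.

Let p0 : 0 < p. Proof. exact: lt_trans p1. Qed.
Let q0 : 0 < p - 1. Proof. by rewrite subr_gt0. Qed.
Let s0 x : 0 < s x. Proof. exact: powR_gt0. Qed.
Let ms : measurable_fun setT s.
Proof. exact: (measurableT_comp (measurable_powR _) mw). Qed.

Let Gle i j : (i <= j)%N -> G i `<=` G j.
Proof.
elim: j => [|j IH]; first by rewrite leqn0 => /eqP ->.
rewrite leq_eqVlt => /orP[/eqP->//|]; rewrite ltnS => /IH ij.
by apply: (subset_trans ij).
Qed.

Let al_notin i x : ~ D i x -> al i x = 0.
Proof. by move=> Dx; rewrite /stopped_avg indicE memNset// mulr0. Qed.
Let al_in i x : D i x -> al i x = a i x.
Proof. by move=> Dx; rewrite /stopped_avg indicE mem_set// mulr1. Qed.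
Let m_notin i x : ~ D i x -> m i x = 0.
Proof. by move=> Dx; rewrite /weighted_avg al_notin// mul0r. Qed.
Let m_in i x : D i x -> m i x * si i x = a i x.
Proof.
move=> Dx; rewrite /weighted_avg al_in// powR_inv1 ?ltW ?si0//.
by rewrite divfK// gt_eqF// si0.
Qed.
Let al0 i x : 0 <= al i x.
Proof.
by have [Dx|Dx] := pselect (D i x); [rewrite al_in// a0|rewrite al_notin].
Qed.
Let m0 i x : 0 <= m i x. Proof. by rewrite mulr_ge0// powR_ge0. Qed.
Let A0 n x : 0 <= A n x. Proof. exact: sumr_ge0. Qed.
Let M0 n x : 0 <= M n x.
Proof. by elim: n => //= n IH; rewrite le_max IH. Qed.
Let AS n x : A n.+1 x = A n x + al n x.
Proof. by rewrite /partial_sparse big_ord_recr. Qed.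
Let A_le n x : A n x <= k.
Proof.
elim: n => [|n IH]; first by rewrite /partial_sparse big_ord0.
have [Dx|Dx] := pselect (D n x); first exact: A_bound.
by rewrite AS al_notin// addr0.
Qed.
Let M_le n x : M n x <= k.
Proof.
elim: n => [//|n IH] /=; rewrite ge_max IH /=.
by have [Dx|Dx] := pselect (D n x); [exact: m_bound|rewrite m_notin].
Qed.

Let gal i j : (i <= j)%N -> gmeasurable_fun (G j) (al i).
Proof.
move=> ij; apply: (sub_gmeasurable_fun (sG i) (sG j) (Gle ij)).
by apply: measurable_funM => //; [exact: ma|exact: gmeasurable_indic].
Qed.
Let gm i j : (i <= j)%N -> gmeasurable_fun (G j) (m i).
Proof.
move=> ij; apply: measurable_funM; first exact: gal.
apply: (sub_gmeasurable_fun (sG i) (sG j) (Gle ij)).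
by apply: gmeasurable_powR; exact: msi.
Qed.
(** A_n involves only averages of index below n, so A_(j+1) is already measurable for [G j]. This
    shift lets A_(n+1)^(p-1) act as a known factor at stage n; the same holds for the maxima
    below. *)
Let gA n j : (n <= j.+1)%N -> gmeasurable_fun (G j) (A n).
Proof.
elim: n => [_|n IH nj].
  rewrite (_ : A 0 = cst 0); first exact: measurable_cst.
  by apply/funext => x; rewrite /partial_sparse big_ord0.
rewrite (_ : A n.+1 = fun x => A n x + al n x); last by apply/funext => x.
by apply: measurable_funD; [apply: IH; exact: ltnW|exact: gal].
Qed.
Let gM n j : (n <= j.+1)%N -> gmeasurable_fun (G j) (M n).
Proof.
elim: n => [_|n IH nj]; first exact: measurable_cst.
by apply: measurable_maxr; [apply: IH; exact: ltnW|exact: gm].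
Qed.
Let mA n : measurable_fun setT (A n).
Proof. by apply: (gmeasurable_fun_measurable (sG n)); exact: gA. Qed.
Let mM n : measurable_fun setT (M n).
Proof. by apply: (gmeasurable_fun_measurable (sG n)); exact: gM. Qed.
Let mal i : measurable_fun setT (al i).
Proof. by apply: (gmeasurable_fun_measurable (sG i)); exact: gal. Qed.
Let mm i : measurable_fun setT (m i).
Proof. by apply: (gmeasurable_fun_measurable (sG i)); exact: gm. Qed.
Let mpow (g : T -> R) q : measurable_fun setT g -> measurable_fun setT (fun x => g x `^ q).
Proof. exact: (measurableT_comp (measurable_powR _)). Qed.
Let mD i : measurable (D i). Proof. exact: (sG i).2. Qed.

(** * Doob's maximal inequality for the measure s dP *)

Local Open Scope ereal_scope.

(** The increment of M^(p-1) is measurable for [G n] and vanishes off [D n]. It therefore allows s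
    to be replaced by [si n], then m_n [si n] to be read as a_n, and finally a_n to be replaced by
    f. *)
Let doob_increment n :
  \int[P]_x ((M n.+1 x `^ (p - 1) - M n x `^ (p - 1)) * m n x * s x)%:E <=
  \int[P]_x ((M n.+1 x `^ (p - 1) - M n x `^ (p - 1)) * f x)%:E.
Proof.
pose de x := (M n.+1 x `^ (p - 1) - M n x `^ (p - 1))%R.
have de0 x : (0 <= de x)%R.
  rewrite subr_ge0 ge0_ler_powR ?nnegrE ?M0 ?(ltW q0)//.
  by rewrite /= le_max lexx.
have deN x : ~ D n x -> de x = 0%R.
  by move=> Dx; rewrite /de /= m_notin// max_l ?subrr.
have gde : gmeasurable_fun (G n) de.
  by apply: measurable_funB; apply: gmeasurable_powR; exact: gM.
have E (g : T -> R) (e : T -> R) x : (e x * \1_(D n) x * g x =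
    if x \in D n then e x * g x else 0)%R.
  by rewrite indicE; case: (x \in D n); rewrite ?mulr1// mulr0 mul0r.
apply: (@le_trans _ _ (\int[P]_x (de x * m n x * \1_(D n) x * s x)%:E)).
  rewrite le_eqVlt; apply/orP; left; apply/eqP; apply: eq_integral => x _.
  rewrite (E s (fun x => de x * m n x)%R).
  by case: ifPn => // /negP; rewrite inE => Dx; rewrite -/(de x) deN// !mul0r.
apply: (@le_trans _ _ (\int[P]_x (de x * m n x * \1_(D n) x * si n x)%:E)).
  apply: (@le_integral_gmeasurable_in _ _ _ _ (G n)) => //.
  - exact: (gmeasurable_fun_measurable (sG n)).
  - by apply: measurable_funM => //; exact: gm.
  - by move=> x _; rewrite ltW.
  - by move=> x Dx; rewrite ltW// si0.
  - by move=> x _; rewrite mulr_ge0.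
  - exact: si_avg.
apply: (@le_trans _ _ (\int[P]_x (de x * \1_(D n) x * a n x)%:E)).
  rewrite le_eqVlt; apply/orP; left; apply/eqP; apply: eq_integral => x _.
  rewrite (E (si n) (fun x => de x * m n x)%R) (E (a n) de).
  by case: ifPn => //; rewrite inE => Dx; rewrite -mulrA m_in.
apply: (@le_trans _ _ (\int[P]_x (de x * \1_(D n) x * f x)%:E)).
  apply: (@le_integral_gmeasurable_in _ _ _ _ (G n)) => //.
  - exact: (gmeasurable_fun_measurable (sG n)).
  - by move=> x Dx; exact: a0.
  - exact: a_avg.
rewrite le_eqVlt; apply/orP; left; apply/eqP; apply: eq_integral => x _.
rewrite (E f de).
by case: ifPn => // /negP; rewrite inE => Dx; rewrite -/(de x) deN// !mul0r.
Qed.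

Lemma partial_max_doob n :
  \int[P]_x (M n x `^ p * s x)%:E <=
  (p / (p - 1))%:E * \int[P]_x (f x * M n x `^ (p - 1))%:E.
Proof.
have q'0 : (0 <= p / (p - 1))%R by rewrite divr_ge0 ?ltW.
have mMs i : measurable_fun setT (fun x => M i x `^ p * s x)%R.
  by apply: measurable_funM => //; exact: mpow.
have mfM i : measurable_fun setT (fun x => f x * M i x `^ (p - 1))%R.
  by apply: measurable_funM => //; exact: mpow.
have Ms0 i x : (0 <= M i x `^ p * s x)%R by rewrite mulr_ge0 ?powR_ge0.
have fM0 i x : (0 <= f x * M i x `^ (p - 1))%R by rewrite mulr_ge0 ?powR_ge0.
elim: n => [|n IH].
  rewrite [leLHS](_ : _ = 0).
    by rewrite mule_ge0 ?lee_fin//; apply: integral_ge0 => x _; rewrite lee_fin.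
  by apply: integral0_eq => x _; rewrite /= powR0 ?mul0r// gt_eqF.
set de := fun x => (M n.+1 x `^ (p - 1) - M n x `^ (p - 1))%R.
have de0 x : (0 <= de x)%R.
  rewrite subr_ge0 ge0_ler_powR ?nnegrE ?M0 ?(ltW q0)//.
  by rewrite /= le_max lexx.
have mde : measurable_fun setT de by apply: measurable_funB; exact: mpow.
have dms0 x : (0 <= de x * m n x * s x)%R.
  exact: mulr_ge0 (mulr_ge0 (de0 x) (m0 n x)) (ltW (s0 x)).
have mdms : measurable_fun setT (fun x => de x * m n x * s x)%R.
  by do 2 apply: measurable_funM => //.
have mdf : measurable_fun setT (fun x => de x * f x)%R by exact: measurable_funM.
have df0 x : (0 <= de x * f x)%R by rewrite mulr_ge0.
have step x : (M n.+1 x `^ p * s x <=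
    1 * (M n x `^ p * s x) + p / (p - 1) * (de x * m n x * s x))%R.
  rewrite mul1r.
  have : (M n.+1 x `^ p - M n x `^ p <= p / (p - 1) * (de x * m n x))%R.
    (* Either the maximum stays put and the increment [de] is 0, or it jumps to the value m_n; in
       both cases the factor M_(n+1) of the tangent inequality may be read as m_n. *)
    have [Mm|mM'] := leP (m n x) (M n x).
      by rewrite (_ : de x = 0%R) /de /= max_l// !subrr// mul0r mulr0.
    have -> : m n x = M n.+1 x by rewrite /= max_r// ltW.
    exact: powR_increment_conj_le.
  rewrite lerBlDl -(ler_pM2r (s0 x)) => /le_trans; apply.
  by rewrite mulrDl !mulrA.
apply: (le_trans (@le_integral_comb _ _ _ P _ _ _ _ _ (mMs n) mdms (mMs n.+1)
  (Ms0 n) dms0 (Ms0 n.+1) ler01 q'0 step)).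
rewrite mul1e.
have -> : \int[P]_x (f x * M n.+1 x `^ (p - 1))%:E =
    \int[P]_x (f x * M n x `^ (p - 1))%:E + \int[P]_x (de x * f x)%:E.
  rewrite -(integral_addEFin P (mfM n) mdf (fM0 n) df0).
  by apply: eq_integral => x _; congr (_%:E); rewrite /de; ring.
rewrite [leRHS]ge0_muleDr; last 2 first.
- by apply: integral_ge0 => x _; rewrite lee_fin.
- by apply: integral_ge0 => x _; rewrite lee_fin.
apply: leeD => //.
by apply: lee_wpmul2l; [rewrite lee_fin|exact: doob_increment].
Qed.

(** Young's inequality splits the right side of [partial_max_doob], and the part containing M is
    absorbed. *)
Lemma partial_max_le n :
  \int[P]_x (M n x `^ p * s x)%:E <=
  ((p / (p - 1)) `^ p)%:E * \int[P]_x (f x `^ p * w x)%:E.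
Proof.
have q'0 : (0 <= p / (p - 1))%R by rewrite divr_ge0 ?ltW.
have mMs : measurable_fun setT (fun x => M n x `^ p * s x)%R.
  by apply: measurable_funM => //; exact: mpow.
have mfw : measurable_fun setT (fun x => f x `^ p * w x)%R.
  by apply: measurable_funM => //; exact: mpow.
have Ms0 x : (0 <= M n x `^ p * s x)%R by rewrite mulr_ge0 ?powR_ge0.
have fw0 x : (0 <= f x `^ p * w x)%R by rewrite mulr_ge0 ?powR_ge0// ltW.
have p10 : (0 <= 1 - p^-1)%R by rewrite subr_ge0 invf_le1 ?ltW.
apply: (@young_absorb _ p) => //.
- exact: powR_ge0.
- by apply: integral_ge0 => x _; rewrite lee_fin.
(* The truncation is used here: M is at most [k] and s is integrable, so the integral to be absorbed
   is finite. *)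
- apply: (@le_lt_trans _ _ (\int[P]_x (k `^ p * s x)%:E)).
    apply: le_integral_EFin => //; first exact: measurable_funM.
    move=> x; rewrite ler_pM2r// ge0_ler_powR ?nnegrE// ltW//.
  rewrite integral_scaleEFin ?powR_ge0//; last by move=> x; rewrite ltW.
  by rewrite lte_mul_pinfty ?lee_fin ?powR_ge0.
- by apply: integral_ge0 => x _; rewrite lee_fin.
apply: (le_trans (partial_max_doob n)).
have mfM : measurable_fun setT (fun x => f x * M n x `^ (p - 1))%R.
  by apply: measurable_funM => //; exact: mpow.
have fM0 x : (0 <= f x * M n x `^ (p - 1))%R by rewrite mulr_ge0 ?powR_ge0.
rewrite -(integral_scaleEFin P mfM fM0 q'0).
apply: (@le_integral_comb _ _ _ P _ _ _ _ _ mfw mMs) => //.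
- exact: measurable_funM.
- by move=> x; exact: mulr_ge0.
- by rewrite divr_ge0 ?powR_ge0// ltW.
move=> x; move: (p / (p - 1))%R q'0 => q' q'0.
(* The factors w^(1/p) and s^(1/p) are chosen because s^((p-1)/p) = w^(-1/p), so they cancel in the
   product. *)
have := @young_powR _ p (q' * f x * w x `^ p^-1) (M n x * s x `^ p^-1) p1.
rewrite !powRM ?mulr_ge0 ?powR_ge0// => /(_ isT isT).
rewrite -!powRrM mulVf ?gt_eqF// !mulr1 powRr1 ?(ltW (w0 x))//.
rewrite [leLHS](_ : _ = (q' * (f x * M n x `^ (p - 1)))%R).
  by move=> /le_trans; apply; rewrite le_eqVlt; apply/orP; left; apply/eqP; ring.
have -> : (- (p - 1)^-1 * (p^-1 * (p - 1)) = - p^-1)%R.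
  by field; rewrite !gt_eqF.
rewrite powRN; field; rewrite !gt_eqF// powR_gt0//.
Qed.

(** * The part of [S i] where both weights are controlled by their averages *)

Let K0 : (0 < K)%R. Proof. exact: lt_le_trans K1. Qed.
Let L1 : (1 <= 4 * K)%R. Proof. by move: K1; lra. Qed.
Let L0 : (0 < 4 * K)%R. Proof. exact: lt_le_trans L1. Qed.

(** Conditional form of Markov's inequality: v / (4K vi) exceeds 1 on the exceptional set, while the
    integral of v / vi over B is at most P B because 1 / vi is a known factor. *)
Let markov i (v vi : T -> R) (B : set T) : G i B -> B `<=` D i ->
  measurable_fun setT v -> gmeasurable_fun (G i) vi ->
  (forall x, (0 <= v x)%R) -> (forall x, D i x -> (0 < vi x)%R) ->
  (forall C, G i C -> C `<=` D i ->
    \int[P]_(x in C) (v x)%:E <= \int[P]_(x in C) (vi x)%:E) ->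
  P (B `&` [set x | (4 * K * vi x < v x)%R]) <= ((4 * K)^-1)%:E * P B.
Proof.
move=> GB BD mv gvi v0 vi0 avg.
have mB : measurable B by exact: (sG i).2.
have mvi := gmeasurable_fun_measurable (sG i) gvi.
set C := [set x | _].
have mC : measurable C.
  rewrite -[C]setTI.
  have : measurable_fun setT (fun x => 4 * K * vi x < v x)%R.
    by apply: measurable_fun_ltr => //; exact: measurable_funM.
  by move=> /(_ measurableT [set true]); apply.
have gvi1 : gmeasurable_fun (G i) (fun x => vi x `^ (-1))%R.
  exact: gmeasurable_powR.
have vi10 x : (0 <= vi x `^ (-1))%R by exact: powR_ge0.
have mB1 : measurable_fun setT (\1_B : T -> R) by exact: measurable_indic.
have mvi1 : measurable_fun setT (fun x => vi x `^ (-1) * \1_B x)%R.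
  by apply: measurable_funM => //; exact: (gmeasurable_fun_measurable (sG i)).
have -> : P (B `&` C) = \int[P]_x (\1_(B `&` C) x)%:E.
  by rewrite integral_indic ?setIT//; exact: measurableI.
apply: (@le_trans _ _ (\int[P]_x ((4 * K)^-1 * (vi x `^ (-1) * \1_B x * v x))%:E)).
  apply: le_integral_EFin.
  - by apply: measurable_indic; exact: measurableI.
  - by apply: measurable_funM => //; exact: measurable_funM.
  - by move=> x; rewrite indicE.
  move=> x; rewrite !indicE in_setI; have [xB|_] := boolP (x \in B); last first.
    by rewrite mulr0 mul0r mulr0.
  rewrite inE in xB; have vix := vi0 x (BD x xB).
  have [xC|_] := boolP (x \in C) => /=; last first.
    by rewrite mulr1 mulr_ge0 ?invr_ge0 ?(ltW L0)// mulr_ge0.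
  rewrite inE /C /= in xC; rewrite mulr1 powR_inv1 ?(ltW vix)// mulrA -invfM.
  by rewrite mulrC ler_pdivlMr ?mulr_gt0// mul1r mulrC ltW// mulrC.
rewrite integral_scaleEFin ?invr_ge0 ?(ltW L0)//; last 2 first.
- exact: measurable_funM.
- by move=> x; rewrite mulr_ge0// mulr_ge0// indicE.
apply: lee_wpmul2l; first by rewrite lee_fin invr_ge0 ltW.
apply: (@le_trans _ _ (\int[P]_x (vi x `^ (-1) * \1_B x * vi x)%:E)).
  apply: (@le_integral_gmeasurable_in _ _ _ _ (G i)) => //.
  - by move=> x Bx; rewrite ltW// vi0//; exact: BD.
  - by move=> C' GC C'B; apply: avg => //; exact: subset_trans BD.
rewrite le_eqVlt; apply/orP; left; apply/eqP.
have <- : \int[P]_x (\1_B x)%:E = P B by rewrite integral_indic ?setIT.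
apply: eq_integral => x _.
rewrite indicE; have [xB|_] := boolP (x \in B); last by rewrite mulr0 mul0r.
rewrite inE in xB; have vix := vi0 x (BD x xB).
by rewrite mulr1 powR_inv1 ?(ltW vix)// mulVf// gt_eqF.
Qed.

Let Sg i := S i `&` ([set x | (w x <= 4 * K * wi i x)%R] `&`
                     [set x | (s x <= 4 * K * si i x)%R]).

Let mSg i : measurable (Sg i).
Proof.
have mle (g h : T -> R) : measurable_fun setT g -> measurable_fun setT h ->
    measurable [set x | (g x <= h x)%R].
  by move=> mg mh; rewrite -[X in measurable X]setTI; exact: measurable_fun_le.
apply: measurableI => //; apply: measurableI; apply: mle => //.
- by apply: measurable_funM => //; exact: (gmeasurable_fun_measurable (sG i)).
- by apply: measurable_funM => //; exact: (gmeasurable_fun_measurable (sG i)).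
Qed.

(** Sparsity gives B and [S i] a common part of measure at least P B / K. Each exceptional set takes
    away at most P B / (4K), so at least P B / (2K) remains; this explains the constant 4K. *)
Let sparse_good i B : G i B -> B `<=` D i ->
  P B <= (2 * K)%:E * P (B `&` Sg i).
Proof.
move=> GB BD.
have mB : measurable B by exact: (sG i).2.
pose B1 := B `&` [set x | (4 * K * wi i x < w x)%R].
pose B2 := B `&` [set x | (4 * K * si i x < s x)%R].
have mlt (g h : T -> R) : measurable_fun setT g -> measurable_fun setT h ->
    measurable [set x | (g x < h x)%R].
  move=> mg mh; rewrite -[X in measurable X]setTI.
  by have /(_ measurableT [set true]) := measurable_fun_ltr mg mh; apply.
have mB1 : measurable B1.
  apply: measurableI => //; apply: mlt => //.
  by apply: measurable_funM => //; exact: (gmeasurable_fun_measurable (sG i)).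
have mB2 : measurable B2.
  apply: measurableI => //; apply: mlt => //.
  by apply: measurable_funM => //; exact: (gmeasurable_fun_measurable (sG i)).
have mBS : measurable (B `&` Sg i) by exact: measurableI.
have PB1 : P B1 <= ((4 * K)^-1)%:E * P B.
  by apply: (@markov i) => //; [move=> x; rewrite ltW|exact: wi0|exact: wi_avg].
have PB2 : P B2 <= ((4 * K)^-1)%:E * P B.
  by apply: (@markov i) => //; [move=> x; rewrite ltW|exact: si0|exact: si_avg].
have PBS : P (B `&` S i) <= P (B `&` Sg i) + (P B1 + P B2).
  apply: (@le_trans _ _ (P ((B `&` Sg i) `|` (B1 `|` B2)))).
    apply: le_measure; rewrite ?inE; [exact: measurableI| |].
      by apply: measurableU => //; exact: measurableU.
    move=> x [Bx Sx]; have [w1|w1] := leP (w x) (4 * K * wi i x)%R; last first.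
      by right; left.
    have [s1|s1] := leP (s x) (4 * K * si i x)%R; last by right; right.
    by left.
  apply: (le_trans (measureU2 P mBS (measurableU _ _ mB1 mB2))).
  by apply: leeD => //; exact: measureU2.
have := sparseS GB BD.
have : P (B `&` S i) \is a fin_num by apply: fin_num_measure; exact: measurableI.
move: PB1 PB2 PBS.
have : P B \is a fin_num by exact: fin_num_measure.
have : P B1 \is a fin_num by exact: fin_num_measure.
have : P B2 \is a fin_num by exact: fin_num_measure.
have : P (B `&` Sg i) \is a fin_num by exact: fin_num_measure.
move: (P B) (P B1) (P B2) (P (B `&` Sg i)) (P (B `&` S i)).
move=> [r||]// [b1||]// [b2||]// [t'||]// [t||]// _ _ _ _.
rewrite !lee_fin => h1 h2 h3 _ h4.
have e1 : (K * (4 * K)^-1 = 4^-1)%R by field; rewrite gt_eqF.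
have k1 : (K * b1 <= 4^-1 * r)%R by rewrite -e1 -mulrA ler_pM2l.
have k2 : (K * b2 <= 4^-1 * r)%R by rewrite -e1 -mulrA ler_pM2l.
have k3 : (K * t <= K * (t' + (b1 + b2)))%R by rewrite ler_pM2l.
move: k1 k2 k3 h4; rewrite !mulrDr -mulrA; lra.
Qed.

(** * Telescoping the powers of the sparse sum *)

Let V x := (w x `^ (1 - p^-1) * s x `^ p^-1)%R.
Let c := (Q `^ Num.max 1 (p - 1)^-1 * (4 * K) `^ (p + (p - 1)^-1))%R.

Let mV : measurable_fun setT V.
Proof. by apply: measurable_funM; exact: mpow. Qed.
Let V0 x : (0 <= V x)%R. Proof. by rewrite mulr_ge0 ?powR_ge0. Qed.
Let c0 : (0 <= c)%R. Proof. by rewrite mulr_ge0 ?powR_ge0. Qed.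

Let b i x := (\1_(D i `&` S i) x * (m i x * A i.+1 x `^ (p - 1)) * V x)%R.
Let mb i : measurable_fun setT (b i).
Proof.
apply: measurable_funM => //; apply: measurable_funM.
  by apply: measurable_indic; exact: measurableI.
by apply: measurable_funM => //; exact: mpow.
Qed.
Let b0 i x : (0 <= b i x)%R.
Proof.
apply: mulr_ge0; last exact: V0.
by apply: mulr_ge0; [rewrite indicE|apply: mulr_ge0; rewrite ?powR_ge0].
Qed.

(** First w is replaced by its average, then the integral over [D n] is moved to [Sg n] at the cost
    of 2K. There a_n equals m_n [si n], and [Ap_product_le] with L = 4K bounds the product of the
    two averages by c V. *)
Let sparse_increment n :
  \int[P]_x (al n x * A n.+1 x `^ (p - 1) * w x)%:E <=
  (2 * K * c)%:E * \int[P]_x (b n x)%:E.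
Proof.
have K20 : (0 <= 2 * K)%R by rewrite mulr_ge0// ltW.
pose H0 x := (a n x * A n.+1 x `^ (p - 1))%R.
have gH0 : gmeasurable_fun (G n) H0.
  by apply: measurable_funM => //; [exact: ma|apply: gmeasurable_powR; exact: gA].
have H00 x : D n x -> (0 <= H0 x)%R by move=> Dx; rewrite mulr_ge0 ?a0 ?powR_ge0.
have H10 x : D n x -> (0 <= H0 x * wi n x)%R.
  by move=> Dx; rewrite mulr_ge0 ?H00// ltW// wi0.
have gwi := gmeasurable_fun_measurable (sG n) (@mwi n).
have mS1 : measurable_fun setT (\1_(Sg n) : T -> R) by exact: measurable_indic.
apply: (@le_trans _ _ (\int[P]_x (H0 x * \1_(D n) x * w x)%:E)).
  rewrite le_eqVlt; apply/orP; left; apply/eqP; apply: eq_integral => x _.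
  by congr (_%:E); rewrite /H0 /stopped_avg; ring.
apply: (@le_trans _ _ (\int[P]_x (H0 x * \1_(D n) x * wi n x)%:E)).
  apply: (@le_integral_gmeasurable_in _ _ _ _ (G n)) => //.
  - by move=> x _; rewrite ltW.
  - by move=> x Dx; rewrite ltW// wi0.
  - exact: wi_avg.
(* Displaying the constant 1 as the function being compared puts [sparse_good] in the form of an
   integral comparison between 1 and 2K times the indicator of [Sg n], with H0 wi as the known
   factor. *)
apply: (@le_trans _ _ (\int[P]_x (H0 x * wi n x * \1_(D n) x * cst 1%R x)%:E)).
  rewrite le_eqVlt; apply/orP; left; apply/eqP; apply: eq_integral => x _.
  by congr (_%:E); rewrite /=; ring.
apply: (@le_trans _ _ (\int[P]_x (H0 x * wi n x * \1_(D n) x *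
    (2 * K * \1_(Sg n) x))%:E)).
  apply: (@le_integral_gmeasurable_in _ _ _ _ (G n)) => //.
  - exact: measurable_funM.
  - by apply: measurable_funM; [exact: gH0|exact: mwi].
  - by move=> x _; rewrite mulr_ge0// indicE.
  - move=> B GB BD; have mB : measurable B by exact: (sG n).2.
    have -> : \int[P]_(x in B) (cst 1%R x)%:E = P B.
      by have := integral_cst P mB 1; rewrite mul1e.
    under eq_integral do rewrite EFinM.
    rewrite ge0_integralZl_EFin//; last first.
      by apply/measurable_EFinP; exact: measurable_funTS.
    by rewrite integral_indic// setIC; exact: sparse_good.
rewrite -(integral_scaleEFin P (mb n) (b0 n) (mulr_ge0 K20 c0)).
apply: le_integral_EFin.
- apply: measurable_funM; last exact: measurable_funM.
  apply: measurable_funM; last exact: measurable_indic.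
  by apply: measurable_funM => //; exact: (gmeasurable_fun_measurable (sG n)).
- exact: measurable_funM.
- move=> x; have H2 : (0 <= H0 x * wi n x * \1_(D n) x)%R.
    rewrite indicE; have [xD|_] := boolP (x \in D n); last by rewrite mulr0.
    by rewrite inE in xD; rewrite mulr1 H10.
  by apply: mulr_ge0 => //; rewrite mulr_ge0.
move=> x; have [[Dx Sx]|xN] := pselect (D n x /\ Sg n x); last first.
  rewrite [leLHS](_ : _ = 0%R); first exact: mulr_ge0 (mulr_ge0 K20 c0) (b0 n x).
  rewrite !indicE; have [xD|_] := boolP (x \in D n); last by rewrite mulr0 mul0r.
  have [xS|_] := boolP (x \in Sg n); last by rewrite !mulr0.
  by rewrite !inE in xD xS; exfalso; apply: xN.
have [Sx' [wx sx]] := Sx.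
rewrite /b !indicE !mem_set//.
have wsx : (wi n x * si n x <= c * V x)%R.
  by apply: Ap_product_le => //; [exact: wi0|exact: si0|exact: ApQ].
rewrite /H0 -(m_in Dx) !mulr1 mul1r.
rewrite [leLHS](_ : _ = 2 * K * (m n x * A n.+1 x `^ (p - 1)) * (wi n x * si n x))%R; last by ring.
rewrite [leRHS](_ : _ = 2 * K * (m n x * A n.+1 x `^ (p - 1)) * (c * V x))%R; last by ring.
by rewrite ler_wpM2l// mulr_ge0// mulr_ge0 ?powR_ge0.
Qed.

Let B n x := (\sum_(i < n) b i x)%R.
Let B0 n x : (0 <= B n x)%R. Proof. exact: sumr_ge0. Qed.
Let mB n : measurable_fun setT (B n). Proof. exact: measurable_sum. Qed.

Let sparse_telescope n :
  \int[P]_x (A n x `^ p * w x)%:E <= (p * (2 * K * c))%:E * \int[P]_x (B n x)%:E.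
Proof.
have K20 : (0 <= 2 * K * c)%R by rewrite mulr_ge0// mulr_ge0// ltW.
have mAw i : measurable_fun setT (fun x => A i x `^ p * w x)%R.
  by apply: measurable_funM => //; exact: mpow.
have Aw0 i x : (0 <= A i x `^ p * w x)%R by rewrite mulr_ge0 ?powR_ge0// ltW.
elim: n => [|n IH].
  rewrite [leLHS](_ : _ = 0).
    apply: mule_ge0; first by rewrite lee_fin; exact: mulr_ge0 (ltW p0) K20.
    by apply: integral_ge0 => x _; rewrite lee_fin.
  apply: integral0_eq => x _.
  by rewrite /partial_sparse big_ord0 powR0 ?mul0r// gt_eqF.
have mi : measurable_fun setT (fun x => al n x * A n.+1 x `^ (p - 1) * w x)%R.
  by do 2 apply: measurable_funM => //; exact: mpow.
have i0 x : (0 <= al n x * A n.+1 x `^ (p - 1) * w x)%R.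
  by rewrite mulr_ge0 ?(ltW (w0 x))// mulr_ge0 ?powR_ge0.
have step x : (A n.+1 x `^ p * w x <=
    1 * (A n x `^ p * w x) + p * (al n x * A n.+1 x `^ (p - 1) * w x))%R.
  rewrite mul1r.
  have := powR_increment_le p1 (A0 n x) (A0 n.+1 x).
  rewrite {2}AS addrAC subrr add0r lerBlDl -(ler_pM2r (w0 x)) => /le_trans; apply.
  by rewrite mulrDl !mulrA.
apply: (le_trans (@le_integral_comb _ _ _ P _ _ _ _ _ (mAw n) mi (mAw n.+1)
  (Aw0 n) i0 (Aw0 n.+1) ler01 (ltW p0) step)).
rewrite mul1e.
have -> : \int[P]_x (B n.+1 x)%:E = \int[P]_x (B n x)%:E + \int[P]_x (b n x)%:E.
  rewrite -(integral_addEFin P (mB n) (mb n) (B0 n) (b0 n)).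
  by apply: eq_integral => x _; rewrite /B big_ord_recr.
rewrite [leRHS]ge0_muleDr; last 2 first.
- by apply: integral_ge0 => x _; rewrite lee_fin.
- by apply: integral_ge0 => x _; rewrite lee_fin.
apply: leeD => //; rewrite EFinM -muleA.
by apply: lee_wpmul2l; [rewrite lee_fin ltW|exact: sparse_increment].
Qed.

(** At a point of [D n] all earlier summands vanish, because a point of [S i] lies in no later
    [D j]; the last term alone remains. Off [D n] neither the sum nor the bound changes. *)
Let B_le n x : (B n x <= M n x * A n x `^ (p - 1) * V x)%R.
Proof.
elim: n => [|n IH]; first by rewrite /B big_ord0 mul0r mul0r.
rewrite /B big_ord_recr /= -/(B n x).
have [Dx|Dx] := pselect (D n x).
  have -> : B n x = 0%R.
    rewrite /B big1// => i _; rewrite /b indicE memNset ?mul0r//.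
    by move=> [_ Sx]; exact: (SD (ltn_ord i) Sx Dx).
  rewrite add0r ler_wpM2r//.
  apply: (@le_trans _ _ (m n x * A n.+1 x `^ (p - 1))%R).
    apply: ler_piMl; first exact: mulr_ge0 (m0 n x) (powR_ge0 _ _).
    by rewrite indicE lern1; case: (x \in _).
  by rewrite ler_wpM2r ?powR_ge0// le_max lexx orbT.
have -> : b n x = 0%R by rewrite /b indicE memNset ?mul0r// => -[].
rewrite addr0 (le_trans IH)// AS al_notin// addr0 m_notin//.
by rewrite max_l.
Qed.

Lemma partial_sparse_le n :
  \int[P]_x (A n x `^ p * w x)%:E <=
  ((p * (2 * K * (Q `^ Num.max 1 (p - 1)^-1 * (4 * K) `^ (p + (p - 1)^-1)))
    * (p / (p - 1))) `^ p)%:E * \int[P]_x (f x `^ p * w x)%:E.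
Proof.
rewrite -/c; set C := (p * (2 * K * c))%R.
have C0 : (0 <= C)%R.
  by rewrite mulr_ge0 ?(ltW p0)// mulr_ge0// mulr_ge0// ltW.
have q'0 : (0 <= p / (p - 1))%R by rewrite divr_ge0 ?ltW.
have mMs : measurable_fun setT (fun x => M n x `^ p * s x)%R.
  by apply: measurable_funM => //; exact: mpow.
have Ms0 x : (0 <= M n x `^ p * s x)%R by rewrite mulr_ge0 ?powR_ge0.
have mAw : measurable_fun setT (fun x => A n x `^ p * w x)%R.
  by apply: measurable_funM => //; exact: mpow.
have Aw0 x : (0 <= A n x `^ p * w x)%R by rewrite mulr_ge0 ?powR_ge0// ltW.
have p10 : (0 <= 1 - p^-1)%R by rewrite subr_ge0 invf_le1 ?ltW.
(* The factor C^p will come from the absorption below, and (p/(p-1))^p from the maximal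
   inequality. *)
rewrite powRM// EFinM -muleA.
apply: (@le_trans _ _ ((C `^ p)%:E * \int[P]_x (M n x `^ p * s x)%:E)); last first.
  by apply: lee_wpmul2l; [rewrite lee_fin powR_ge0|exact: partial_max_le].
apply: (@young_absorb _ p) => //.
- exact: powR_ge0.
- by apply: integral_ge0 => x _; rewrite lee_fin.
- apply: (@le_lt_trans _ _ (\int[P]_x (k `^ p * w x)%:E)).
    apply: le_integral_EFin => //; first exact: measurable_funM.
    by move=> x; rewrite ler_pM2r// ge0_ler_powR ?nnegrE// ltW.
  rewrite integral_scaleEFin ?powR_ge0//; last by move=> x; rewrite ltW.
  by rewrite lte_mul_pinfty ?lee_fin ?powR_ge0.
- by apply: integral_ge0 => x _; rewrite lee_fin.
apply: (le_trans (sparse_telescope n)).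
rewrite -/C -(integral_scaleEFin P (mB n) (B0 n) C0).
apply: (@le_integral_comb _ _ _ P _ _ _ _ _ mMs mAw) => //.
- exact: measurable_funM.
- by move=> x; exact: mulr_ge0.
- by rewrite divr_ge0 ?powR_ge0// ltW.
move=> x; apply: (@le_trans _ _ (C * (M n x * A n x `^ (p - 1) * V x))%R).
  by rewrite ler_wpM2l.
rewrite /V; move: C C0 => C C0.
(* Young's inequality for C M s^(1/p) and A w^(1/p): the factor [V] is exactly s^(1/p) times
   w^((p-1)/p). *)
have := @young_powR _ p (C * M n x * s x `^ p^-1) (A n x * w x `^ p^-1) p1.
rewrite !powRM ?mulr_ge0 ?powR_ge0// => /(_ isT isT).
rewrite -!powRrM divfK ?gt_eqF// mulVf ?gt_eqF// powRr1 ?(ltW (w0 x))//.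
have -> : (p^-1 * (p - 1) = 1 - p^-1)%R by rewrite mulrBr mulr1 mulVf// gt_eqF.
set W := (w x `^ (- (p - 1)^-1 / p))%R; set W' := (w x `^ (- (p - 1)^-1))%R.
move=> H; rewrite [leLHS](_ : _ =
  (C * M n x * W * (A n x `^ (p - 1) * w x `^ (1 - p^-1)))%R); last by ring.
apply: (le_trans H).
by rewrite le_eqVlt; apply/orP; left; apply/eqP; ring.
Qed.

End bounded_sparse_estimate.

(** * Times of the iterated local spaces *)

Section global_times.
Context (d : measure_display) (T : measurableType d) (R : realType).
Variables (P : probability T R) (F : nat -> set (set T)).
Hypothesis fps : filtered_probability_space P F.

Let sF n : sub_salgebra (F n).
Proof. by split; [exact: (fps_sigma fps)|exact: (fps_sub fps)]. Qed.

Definition time_add (s t : T -> option nat) : T -> option nat :=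
  fun x => obind (fun a => omap (addn a) (t x)) (s x).

Lemma time_addE s t x n : time_add s t x = Some n <->
  exists2 a, (a <= n)%N & s x = Some a /\ t x = Some (n - a)%N.
Proof.
rewrite /time_add; split.
  case: (s x) => [a|]//=; case: (t x) => [b|]//= [<-].
  by exists a; rewrite ?leq_addr// addKn.
by move=> [a an [-> ->]] /=; rewrite subnKC.
Qed.

Lemma time_add_NoneE s t x : time_add s t x <> None <-> s x <> None /\ t x <> None.
Proof.
rewrite /time_add; case: (s x) => [a|]; case: (t x) => [b|]/=; split => //.
- by move=> [].
- by move=> [].
- by move=> [].
Qed.

(* The local space [X] is described by one time [s] of the original filtration:
   [X] lives on [s < oo] and its n-th sigma-algebra is that of [s + n]. *)
Record described (X : fspace T R) (s : T -> option nat) : Prop := Described {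
  described_set : fs_set X = [set x | s x <> None];
  described_events : forall A, fs_events X A <-> measurable A /\ A `<=` fs_set X;
  described_filt : forall k A, fs_filt X k A <->
    A `<=` fs_set X /\ forall n, F (n + k)%N (A `&` [set x | s x = Some n]);
  described_measure : exists2 c : R, 0 < c &
    forall A, fs_measure X A = (c%:E * P (A `&` fs_set X))%E;
  described_stopping : forall n, F n [set x | s x = Some n]
}.

Lemma whole_space_described : described (whole_space P F) (fun=> Some 0%N).
Proof.
have s0 n : [set x : T | Some 0%N = Some n] = if n is 0%N then setT else set0.
  by apply/seteqP; case: n => [|n]; split => x.
split => /=.
- by apply/seteqP; split => x.
- by move=> A; split => [mA|[]//]; split.
- move=> k A; split => [FA|[_ /(_ 0%N)]]; last by rewrite s0 setIT.
  by split => // -[|n]; rewrite s0 ?setIT// setI0; exact: salgebra0.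
- by exists 1 => // A; rewrite mul1e setIT.
- by move=> [|n]; rewrite s0; [exact: salgebraT|exact: salgebra0].
Qed.

(** * One passage to a local space *)

Section described_space.
Variables (X : fspace T R) (s t : T -> option nat).
Hypotheses (Xs : described X s) (Xt : stopping_time X t).

(** The event {t = b} is known at stage b of X, and on {s = a} that stage is stage a + b of the
    original filtration. *)
Lemma described_split a b : F (a + b)%N [set x | s x = Some a /\ t x = Some b].
Proof.
have := Xt b; move/(described_filt Xs) => [_ /(_ a)].
congr (F _ _); apply/seteqP; split => x /=; first by move=> [[]].
by move=> [sx tx]; rewrite (described_set Xs)/= sx.
Qed.

Lemma time_add_stopping n : F n [set x | time_add s t x = Some n].
Proof.
rewrite (_ : [set x | _] = \bigcup_(a in [set a | (a <= n)%N])
    [set x | s x = Some a /\ t x = Some (n - a)%N]); last first.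
  apply/seteqP; split => x /=.
    by move/time_addE => [a an ?]; exists a.
  by move=> [a /= an ?]; apply/time_addE; exists a.
apply: salgebra_bigcup => // a /= an.
by have := described_split a (n - a); rewrite subnKC.
Qed.

Lemma stopped_setE : stopped_set X t = [set x | time_add s t x <> None].
Proof.
rewrite /stopped_set (described_set Xs).
by apply/seteqP; split => x /=; rewrite time_add_NoneE.
Qed.

(** One half of the statement that stopping X at t + k is stopping the original filtration at s + t
    + k; the other half is [filt_stopped_events]. The sets are split according to the value of s. *)
Lemma stopped_events_filt k A : stopped_events X (shift_time t k) A ->
  forall n, F (n + k)%N (A `&` [set x | time_add s t x = Some n]).
Proof.
move=> [_ HA] n.
(* Where s = a and s + t = n, the time t + k equals n - a + k, so intersecting with [stopped_by] at
   that index loses nothing. *)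
rewrite (_ : _ `&` _ = \bigcup_(a in [set a | (a <= n)%N])
   ((A `&` stopped_by X (shift_time t k) (n - a + k) `&` [set x | s x = Some a]) `&`
    [set x | s x = Some a /\ t x = Some (n - a)%N])); last first.
  apply/seteqP; split => x /=.
    move=> [Ax /time_addE[a an [sx tx]]]; exists a => //=; split => //; split => //.
    split => //; split; first by rewrite (described_set Xs)/= sx.
    by exists (n - a + k)%N => //; rewrite /shift_time tx.
  move=> [a /= an [[[Ax _] _] ?]]; split => //.
  by apply/time_addE; exists a.
apply: salgebra_bigcup => // a /= an; apply: salgebraI => //.
  have /(described_filt Xs) [_ /(_ a)] := HA (n - a + k)%N.
  by rewrite addnA subnKC.
have := described_split a (n - a); rewrite subnKC// => /(fps_incr fps _); apply.
exact: leq_addr.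
Qed.

Lemma filt_stopped_events k A : A `<=` stopped_set X t ->
  (forall n, F (n + k)%N (A `&` [set x | time_add s t x = Some n])) ->
  stopped_events X (shift_time t k) A.
Proof.
move=> AE HA; have AD : A `<=` fs_set X by move=> x /AE [].
split.
  apply/(described_events Xs); split => //.
  rewrite (_ : A = \bigcup_n (A `&` [set x | time_add s t x = Some n])).
    by apply: bigcup_measurable => n _; exact: (sF _).2 (HA n).
  apply/seteqP; split => x /=; last by move=> [n _ []].
  move=> Ax; have := AE x Ax; rewrite stopped_setE /=.
  by case E : (time_add s t x) => [n|]// _; exists n.
move=> n; apply/(described_filt Xs); split; first by move=> x [/AD].
move=> a.
(* Here b is the value of t. The condition b + k <= n places both factors, known at times a + b + k
   and a + b, in stage a + n. *)
rewrite (_ : _ `&` _ = \bigcup_(b in [set b | (b + k <= n)%N])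
   ((A `&` [set x | time_add s t x = Some (a + b)%N]) `&`
    [set x | s x = Some a /\ t x = Some b])); last first.
  apply/seteqP; split => x /=.
    move=> [[Ax [_ [m]]]]; rewrite /shift_time; case tx : (t x) => [b|]//= [<-].
    move=> bn sx; exists b => //=; split => //; split => //.
    by apply/time_addE; exists a; rewrite ?leq_addr// addKn.
  move=> [b /= bn [[Ax _] [sx tx]]]; split => //; split => //; split; first exact: AD.
  by exists (b + k)%N => //; rewrite /shift_time tx.
apply: salgebra_bigcup => // b /= bn; apply: salgebraI => //.
  by apply: (fps_incr fps _ (HA (a + b)%N)); lia.
by apply: (fps_incr fps _ (described_split a b)); lia.
Qed.

Lemma local_space_described : (0 < fs_measure X (stopped_set X t))%E ->
  described (local_space X t) (time_add s t).
Proof.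
move=> E0; rewrite /local_space E0.
have ED : stopped_set X t `<=` fs_set X by move=> x [].
have mE : measurable (stopped_set X t).
  rewrite stopped_setE (_ : [set x | _] = \bigcup_n [set x | time_add s t x = Some n]).
    by apply: bigcup_measurable => n _; exact: (sF _).2 (time_add_stopping n).
  apply/seteqP; split => x /=; last by move=> [n _ ->].
  by case E : (time_add s t x) => [n|]// _; exists n.
split => /=.
- exact: stopped_setE.
- move=> A; split.
    move=> [B /(described_events Xs)[mB BD] <-]; split; last by move=> x [].
    exact: measurableI.
  move=> [mA AE]; exists A; last exact/setIidl.
  by apply/(described_events Xs); split => //; exact: subset_trans ED.
- move=> k A; split.
    move=> [B /stopped_events_filt HB <-]; split; first by move=> x [].
    move=> n; have := HB n; congr (F _ _); apply/seteqP; split => x /=.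
      move=> [Bx tx]; split => //; split => //.
      by rewrite stopped_setE /= tx.
    by move=> [[]].
  move=> [AE HA]; exists A; last exact/setIidl.
  exact: filt_stopped_events.
- have [c c0 cE] := described_measure Xs.
  have EDE : stopped_set X t `&` fs_set X = stopped_set X t.
    exact/setIidl.
  have Pfin : P (stopped_set X t) \is a fin_num by exact: fin_num_measure.
  have r0 : 0 < fine (fs_measure X (stopped_set X t)).
    move: E0; rewrite cE EDE -(fineK Pfin) -EFinM lte_fin.
    by rewrite /=.
  exists (c / fine (fs_measure X (stopped_set X t))); first by rewrite divr_gt0.
  move=> A; rewrite cE -setIA EDE [RHS]muleC EFinM muleA [in RHS]muleC.
  by rewrite [RHS]muleC [X in (X * _)%E]muleC.
- exact: time_add_stopping.
Qed.

End described_space.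

(** * Global times of a shifted sequence and their sigma-algebras *)

Section global_time.
Variable tau : nat -> T -> option nat.
Hypothesis tauS : shifted_sequence P F tau.

Local Notation X := (iter_space P F tau).

(** The time describing [X i]. It stays put in the degenerate case, where the local space induced by
    a time that is infinite almost surely is the old space. *)
Fixpoint base_time (i : nat) : T -> option nat :=
  if i is j.+1 then
    if (0 < fs_measure (X j) (Eset P F tau j))%E
    then time_add (base_time j) (tau j) else base_time j
  else fun=> Some 0%N.

Definition global_time i := time_add (base_time i) (tau i).

Lemma iter_space_described i :
  described (X i) (base_time i) /\ stopping_time (X i) (tau i).
Proof.
elim: i => [|i [IH1 IH2]].
  split; first exact: whole_space_described.
  move=> n /=; have [t0 _] := tauS.
  rewrite (_ : [set x | _] = if n is 0%N then setT else set0).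
    by case: n => [|n]; [exact: salgebraT|exact: salgebra0].
  by apply/seteqP; case: n => [|n]; split => x //=; rewrite t0 // => -[].
have := tauS.2 i; rewrite /locally_filter_shifted /=.
rewrite -/(Eset P F tau i); case: ifPn => E0.
  by move=> st; split => //; exact: local_space_described.
(* Degenerate case: the space is unchanged and the new time agrees with the old one on it. *)
move=> tt; rewrite /local_space -/(Eset P F tau i) (negbTE E0); split => // n.
have := IH2 n; congr (fs_filt _ _ _); apply/seteqP; split => x /= [Dx].
  by move=> <-; split => //; apply: tt; rewrite inE.
by move=> <-; split => //; apply/esym/tt; rewrite inE.
Qed.

Lemma EsetE i : Eset P F tau i = [set x | global_time i x <> None].
Proof.
by have [h1 h2] := iter_space_described i; exact: stopped_setE.
Qed.

Lemma global_time_stopping i n : F n [set x | global_time i x = Some n].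
Proof. by have [h1 h2] := iter_space_described i; exact: (time_add_stopping h1 h2). Qed.

(** In the regular case the next global time is this one plus a further delay; in the degenerate
    case the two coincide on the space. *)
Lemma global_time_le i x n : global_time i.+1 x = Some n ->
  exists2 a, (a <= n)%N & global_time i x = Some a.
Proof.
have [h1 h2] := iter_space_described i.
have := tauS.2 i; rewrite /locally_filter_shifted -/(Eset P F tau i).
rewrite {1}/global_time /=; case: ifPn => E0 tt /time_addE[a an [sx tx]].
  by exists a.
exists n => //; rewrite /global_time; apply/time_addE; exists a => //.
split => //; rewrite -tx; apply/esym/tt.
by rewrite inE (described_set h1) /= sx.
Qed.

(** The stopped sigma-algebra of [global_time i], tested on the level sets of the time. It lives on
    all of [T], containing every measurable subset of the complement of [Eset P F tau i], so that
    different indices can be compared. *)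
Definition global_algebra i : set (set T) :=
  [set A | measurable A /\ forall n, F n (A `&` [set x | global_time i x = Some n])].

Lemma sub_salgebra_global_algebra i : sub_salgebra (global_algebra i).
Proof.
split; last by move=> A [].
split.
- by split => // n; rewrite set0I; exact: salgebra0.
- move=> A [mA FA]; split; first exact: measurableD.
  move=> n; rewrite (_ : _ `&` _ = [set x | global_time i x = Some n] `&`
      ~` (A `&` [set x | global_time i x = Some n])).
    apply: salgebraI => //; first exact: global_time_stopping.
    exact: salgebraC.
  apply/seteqP; split => x /=; first by move=> [[_ Ax] tx]; split => // -[].
  by move=> [tx NA]; split => //; split => // Ax; apply: NA.
- move=> A GA; split; first by apply: bigcup_measurable => n _; exact: (GA n).1.
  by move=> n; rewrite setI_bigcupl; apply: salgebra_bigcup => // k _; exact: (GA k).2.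
Qed.

Lemma global_algebra_incr i : global_algebra i `<=` global_algebra i.+1.
Proof.
move=> A [mA FA]; split => // n.
rewrite (_ : _ `&` _ = \bigcup_(a in [set a | (a <= n)%N])
    (A `&` [set x | global_time i x = Some a] `&`
     [set x | global_time i.+1 x = Some n])).
  apply: salgebra_bigcup => // a /= an; apply: salgebraI => //.
    exact: (fps_incr fps an (FA a)).
  exact: global_time_stopping.
apply/seteqP; split => x /=; last by move=> [a _ [[]]].
by move=> [Ax tx]; have [a an ax] := global_time_le tx; exists a.
Qed.

Lemma measurable_Eset i : measurable (Eset P F tau i).
Proof.
rewrite EsetE (_ : [set x | _] = \bigcup_n [set x | global_time i x = Some n]).
  by apply: bigcup_measurable => n _; exact: (sF _).2 (global_time_stopping i n).
apply/seteqP; split => x /=; last by move=> [n _ ->].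
by case E : (global_time i x) => [n|]// _; exists n.
Qed.

Lemma global_algebra_Eset i : global_algebra i (Eset P F tau i).
Proof.
split; first exact: measurable_Eset.
move=> n; rewrite EsetE (_ : _ `&` _ = [set x | global_time i x = Some n]).
  exact: global_time_stopping.
by apply/seteqP; split => x /=; [case|move=> ->].
Qed.

Lemma Eset_decr i : Eset P F tau i.+1 `<=` Eset P F tau i.
Proof.
rewrite !EsetE => x /=; case E : (global_time i.+1 x) => [n|]// _.
by have [a _ ->] := global_time_le E.
Qed.

Lemma shift_time0 (t : T -> option nat) : shift_time t 0 = t.
Proof. by apply/funext => x; rewrite /shift_time; case: (t x) => //= n; rewrite addn0. Qed.

Lemma global_algebra_stopped_events i A : A `<=` Eset P F tau i ->
  global_algebra i A <-> stopped_events (X i) (tau i) A.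
Proof.
move=> AE; have [h1 h2] := iter_space_described i; split.
  move=> [mA FA]; rewrite -(shift_time0 (tau i)).
  by apply: (filt_stopped_events h1 h2 AE) => n; rewrite addn0; exact: FA.
move=> /[dup] -[/(described_events h1)[mA _] _].
rewrite -{1}(shift_time0 (tau i)) => HA; split => // n.
by have := stopped_events_filt h1 h2 HA n; rewrite addn0.
Qed.

Lemma stopped_events_global_algebra i A :
  stopped_events (X i) (tau i) A -> global_algebra i (A `&` Eset P F tau i).
Proof.
have [h1 h2] := iter_space_described i.
move=> /[dup] -[/(described_events h1)[mA _] _].
rewrite -{1}(shift_time0 (tau i)) => HA; split.
  by apply: measurableI => //; exact: measurable_Eset.
move=> n; have := stopped_events_filt h1 h2 HA n; rewrite addn0.
congr (F _ _); rewrite EsetE; apply/seteqP; split => x /=; last by move=> [[]].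
by move=> [Ax tx]; split => //; split => //; rewrite /global_time tx.
Qed.

End global_time.

End global_times.

(** * Averages along the iterated local spaces *)

Lemma measure0_of_integral_le0 (d : measure_display) (T : measurableType d)
  (R : realType) (mu : {measure set T -> \bar R}) (A : set T) (g : T -> R) :
  measurable A -> measurable_fun A g -> {ae mu, forall x, A x -> 0 < g x} ->
  (\int[mu]_(x in A) (g x)%:E <= 0)%E -> mu A = 0%E.
Proof.
move=> mA mg g0 ig.
have mgE : measurable_fun A (EFin \o g) by exact/measurable_EFinP.
have i0 : (\int[mu]_(x in A) `|(EFin \o g) x| = 0)%E.
  apply/eqP; rewrite eq_le; apply/andP; split; last exact: integral_ge0.
  apply: le_trans ig; rewrite le_eqVlt; apply/orP; left; apply/eqP.
  apply: ae_eq_integral => //; first exact: measurableT_comp.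
  by apply: filterS g0 => x /[apply] gx; rewrite /= gtr0_norm.
move/(ae_eq_integral_abs mu mA mgE) : i0 => gE.
have [N [mN N0 AN]] : {ae mu, forall x, ~ A x}.
  by apply: filterS2 g0 gE => x gx gE Ax; have := gx Ax; have [->] := gE Ax; rewrite ltxx.
apply/eqP; rewrite -measure_le0 -N0; apply: le_measure; rewrite ?inE//.
by move=> x Ax; apply: AN => /=; apply.
Qed.

Lemma measure0_of_integral_ge0 (d : measure_display) (T : measurableType d)
  (R : realType) (mu : {measure set T -> \bar R}) (A : set T) (g : T -> R) :
  measurable A -> measurable_fun A g -> (forall x, A x -> g x < 0) ->
  (0 <= \int[mu]_(x in A) (g x)%:E)%E -> mu A = 0%E.
Proof.
move=> mA mg g0 ig.
apply: (@measure0_of_integral_le0 _ _ _ mu A (fun x => - g x)) => //.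
- exact: measurableT_comp.
- by apply: aeW => x Ax; rewrite oppr_gt0 g0.
rewrite -oppe_ge0 -integral_ge0N//.
  by under eq_integral do rewrite -EFinN opprK.
by move=> x Ax; rewrite lee_fin oppr_ge0 ltW// g0.
Qed.

Section averages.
Context (d : measure_display) (T : measurableType d) (R : realType).
Variables (P : probability T R) (F : nat -> set (set T)).
Hypothesis fps : filtered_probability_space P F.

Let sF n : sub_salgebra (F n).
Proof. by split; [exact: (fps_sigma fps)|exact: (fps_sub fps)]. Qed.

Lemma described_measurable X s : described P F X s -> measurable (fs_set X).
Proof.
move=> Xs; rewrite (described_set Xs).
rewrite (_ : [set x | _] = \bigcup_n [set x | s x = Some n]).
  by apply: bigcup_measurable => n _; exact: (sF _).2 (described_stopping Xs n).
apply/seteqP; split => x /=; last by move=> [n _ ->].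
by case E : (s x) => [n|]// _; exists n.
Qed.

Lemma described_measureE X s : described P F X s ->
  exists (c : {nonneg R}) (mD : measurable (fs_set X)),
    0 < c%:num /\ fs_measure X = mscale c (mrestr P mD).
Proof.
move=> Xs; have mD := described_measurable Xs.
have [c c0 cE] := described_measure Xs; exists (NngNum (ltW c0)), mD.
by split => //; apply/funext => B; rewrite cE.
Qed.

(** The normalised local measure is a positive multiple of P on its space, so inequalities between
    integrals hold for one exactly when they hold for the other. *)
Lemma described_integral X s : described P F X s -> exists2 c : R, 0 < c &
  forall A (h : T -> \bar R), measurable A -> A `<=` fs_set X ->
    measurable_fun A h -> (forall x, A x -> (0 <= h x)%E) ->
    (\int[fs_measure X]_(x in A) h x = c%:E * \int[P]_(x in A) h x)%E.
Proof.
move=> /described_measureE[c [mD [c0 ->]]]; exists c%:num => // A h mA AD mh h0.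
rewrite -(ge0_integral_mscale _ _ c)//; apply: eq_measure_integral => B mB BA.
rewrite /= /mscale; congr (_ * _)%E.
by rewrite /= /mrestr setIidl//; exact: subset_trans AD.
Qed.

(** * Conditional expectations on the local spaces *)

Section local.
Variable tau : nat -> T -> option nat.
Hypothesis tauS : shifted_sequence P F tau.
Local Notation X := (iter_space P F tau).
Local Notation G := (global_algebra P F tau).
Local Notation E := (Eset P F tau).
Local Notation sG := (sub_salgebra_global_algebra fps tauS).
Variables (i : nat) (h : T -> R).
Hypotheses (mh : measurable_fun setT h) (h0 : forall x, 0 <= h x).

(* [condexp] is [cst 0] when no version exists. *)
Let dichotomy : is_condexp (X i) (stopped_events (X i) (tau i)) h
    (condexp (X i) (stopped_events (X i) (tau i)) h) \/
  local_avg P F tau i h = cst 0.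
Proof.
rewrite /local_avg /condexp; case: xgetP => [g _ gE|_]; first by left.
by right; apply/funext => x /=; rewrite mul0r.
Qed.

Lemma gmeasurable_local_avg : gmeasurable_fun (G i) (local_avg P F tau i h).
Proof.
case: dichotomy => [|->]; last exact: measurable_cst.
rewrite /local_avg; set g := condexp _ _ _; move=> [mg _ _].
apply/(gmeasurable_funP _ (sG i)) => B mB.
have GE := global_algebra_Eset fps tauS i.
(* Off [E i] the average is 0, so the preimage contains the whole complement or none of it according
   to whether 0 is in B. *)
rewrite (_ : _ @^-1` _ = ((fs_set (X i) `&` g @^-1` B) `&` E i) `|`
    (if 0 \in B then ~` E i else set0)); last first.
  apply/seteqP; split => x /=.
    rewrite indicE; have [xE|xE] := boolP (x \in E i).
      rewrite mulr1 => Bx; left; rewrite inE in xE; split => //; split => //.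
      by case: xE.
    rewrite mulr0 => B0; right; rewrite mem_set//= => xE'.
    by move/negP : xE; apply; rewrite inE.
  move=> [[[_ Bx] Ex]|]; first by rewrite indicE mem_set// mulr1.
  by case: ifPn => //; rewrite inE => B0 /= nE; rewrite indicE memNset// mulr0.
apply: salgebraU; first exact: sG.
  by apply: stopped_events_global_algebra => //; exact: mg.
case: ifP => _; [apply: salgebraC => //; exact: sG|].
by apply: salgebra0; exact: sG.
Qed.

Let condexp_integral A : G i A -> A `<=` E i ->
  is_condexp (X i) (stopped_events (X i) (tau i)) h
    (condexp (X i) (stopped_events (X i) (tau i)) h) ->
  (\int[fs_measure (X i)]_(x in A) (local_avg P F tau i h x)%:E =
   \int[fs_measure (X i)]_(x in A) (h x)%:E)%E.
Proof.
move=> GA AE [_ _ gE]; rewrite -gE; last first.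
  by apply/(global_algebra_stopped_events fps tauS AE).
have [Xs _] := iter_space_described fps tauS i.
have [c [mD [_ ->]]] := described_measureE Xs.
apply: eq_integral => x; rewrite inE => /AE Ex.
by rewrite /local_avg indicE mem_set// mulr1.
Qed.

(** Equality holds if a version of the conditional expectation exists, the scaling of the local
    measure cancelling; for the default value 0 the inequality follows from h >= 0. *)
Lemma local_avg_integral_le A : G i A -> A `<=` E i ->
  (forall x, A x -> 0 <= local_avg P F tau i h x) ->
  (\int[P]_(x in A) (local_avg P F tau i h x)%:E <= \int[P]_(x in A) (h x)%:E)%E.
Proof.
move=> GA AE a0; have mA : measurable A by exact: (sG i).2.
have hpos : (0 <= \int[P]_(x in A) (h x)%:E)%E.
  by apply: integral_ge0 => x _; rewrite lee_fin.
have mg := gmeasurable_fun_measurable (sG i) gmeasurable_local_avg.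
case: dichotomy => [ce|->]; last by rewrite integral0.
have [Xs _] := iter_space_described fps tauS i.
have [c c0 cE] := described_integral Xs.
have AD : A `<=` fs_set (X i) by move=> x /AE [].
have := condexp_integral GA AE ce.
have mgA : measurable_fun A (EFin \o local_avg P F tau i h).
  exact/measurable_EFinP/measurable_funTS.
have mhA : measurable_fun A (EFin \o h).
  exact/measurable_EFinP/measurable_funTS.
have hA x : A x -> (0 <= (h x)%:E)%E by rewrite lee_fin.
rewrite (cE _ _ mA AD mgA a0) (cE _ _ mA AD mhA hA).
by move=> e; rewrite -(@lee_pmul2l _ c%:E)// e.
Qed.

(** The set where the average is negative belongs to [G i], and there its integral equals that of h,
    which is nonnegative; hence the set is null. *)
Lemma local_avg_ge0 : {ae P, forall x, 0 <= local_avg P F tau i h x}.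
Proof.
case: dichotomy => [ce|->]; last by apply: aeW => x.
set a := local_avg P F tau i h; pose A := a @^-1` `]-oo, 0[.
have GA : G i A.
  apply: (proj1 (gmeasurable_funP _ (sG i)) gmeasurable_local_avg).
  exact: measurable_itv.
have mA : measurable A by exact: (sG i).2.
have ma := gmeasurable_fun_measurable (sG i) gmeasurable_local_avg.
have AE : A `<=` E i.
  move=> x; rewrite /A /a /= in_itv /= /local_avg indicE.
  have [|_] := boolP (x \in E i); first by rewrite inE.
  by rewrite mulr0 ltxx.
have a0 x : A x -> a x < 0 by rewrite /A /= in_itv.
exists A; split => //; last first.
  by move=> x /= /negP; rewrite -ltNge /A /= in_itv.
have [Xs _] := iter_space_described fps tauS i.
have [c [mD [c0 cE]]] := described_measureE Xs.
have AD : A `<=` fs_set (X i) by move=> x /AE [].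
have : mscale c (mrestr P mD) A = 0%E.
  apply: (@measure0_of_integral_ge0 _ _ _ (mscale c (mrestr P mD)) A a) => //.
    exact: measurable_funTS.
  have := condexp_integral GA AE ce; rewrite cE => ->.
  by apply: integral_ge0 => x _; rewrite lee_fin.
rewrite /mscale /= /mrestr setIidl// => /eqP; rewrite mule_eq0 => /orP[|/eqP//].
by rewrite eqe gt_eqF.
Qed.

End local.

(** * Sparsity on sets, and averages of the weights at the global times *)

Section glued.
Variable tau : nat -> T -> option nat.
Hypothesis tauS : shifted_sequence P F tau.
Local Notation G := (global_algebra P F tau).
Local Notation E := (Eset P F tau).
Local Notation gt := (global_time P F tau).
Local Notation sG := (sub_salgebra_global_algebra fps tauS).

Lemma measurable_Sset i : measurable (Sset P F tau i).
Proof. by apply: measurableD; exact: measurable_Eset. Qed.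

Lemma sparse_measure_le (K : R) i A : 1 <= K ->
  {ae P, forall x, \1_(E i) x <= K * local_avg P F tau i (\1_(Sset P F tau i)) x} ->
  G i A -> A `<=` E i -> (P A <= K%:E * P (A `&` Sset P F tau i))%E.
Proof.
move=> K1 sp GA AE; have K0 : 0 < K by exact: lt_le_trans K1.
pose h : T -> R := \1_(Sset P F tau i); pose a := local_avg P F tau i h.
have mS := measurable_Sset i.
have mh : measurable_fun setT (h : T -> R) by exact: measurable_indic.
have h0 (x : T) : 0 <= h x :> R by rewrite /h indicE.
have ga : gmeasurable_fun (G i) a by exact: gmeasurable_local_avg.
have ma := gmeasurable_fun_measurable (sG i) ga.
(* [local_avg_integral_le] requires a pointwise sign, so the part of A where the average is negative
   is dropped. The sparsity inequality makes that part null. *)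
pose A' := A `&` a @^-1` `[0, +oo[.
have GA' : G i A'.
  apply: salgebraI => //; first exact: sG.
  apply: (proj1 (gmeasurable_funP _ (sG i)) ga); exact: measurable_itv.
have mA : measurable A by exact: (sG i).2.
have mA' : measurable A' by exact: (sG i).2.
have a0 x : A' x -> 0 <= a x by move=> [_] /=; rewrite in_itv /= andbT.
have -> : P A = P A'.
  apply/eqP; rewrite eq_le; apply/andP; split; last first.
    by apply: le_measure; rewrite ?inE// => x [].
  have [N [mN N0 aN]] := sp.
  have NA : A `<=` A' `|` N.
    move=> x Ax; have [xN|xN] := pselect (N x); [by right|left; split => //].
    have := contra_notP (aN x) xN.
    rewrite /= indicE mem_set; last exact: AE.
    move=> H; rewrite in_itv /= andbT -(pmulr_rge0 _ K0).
    by apply: le_trans H.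
  apply: (@le_trans _ _ (P (A' `|` N))).
    by apply: le_measure; rewrite ?inE//; exact: measurableU.
  apply: (@le_trans _ _ (P A' + P N)%E); first exact: measureU2.
  by rewrite N0 adde0.
apply: (@le_trans _ _ (K%:E * P (A' `&` Sset P F tau i))%E); last first.
  apply: lee_wpmul2l; first by rewrite lee_fin ltW.
  apply: le_measure; rewrite ?inE; [exact: measurableI|exact: measurableI|].
  by move=> x [[]].
have -> : P A' = (\int[P]_(x in A') (cst 1 x))%E by rewrite integral_cst// mul1e.
apply: (@le_trans _ _ (\int[P]_(x in A') (K * a x)%:E)%E).
  apply: ae_ge0_le_integral => //.
  - by move=> x A'x; rewrite lee_fin mulr_ge0 ?(ltW K0)//; exact: a0.
  - by apply/measurable_EFinP; apply: measurable_funM => //; exact: measurable_funTS.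
  - apply: filterS sp => x H [Ax _]; move: H.
    by rewrite indicE mem_set ?lee_fin//; exact: AE.
under eq_integral do rewrite EFinM.
rewrite ge0_integralZl_EFin ?(ltW K0)//; last first.
  by apply/measurable_EFinP; exact: measurable_funTS.
apply: lee_wpmul2l; first by rewrite lee_fin ltW.
have -> : P (A' `&` Sset P F tau i) = (\int[P]_(x in A') (h x)%:E)%E.
  by rewrite integral_indic// setIC.
have A'E : A' `<=` E i by move=> x [/AE].
exact: (local_avg_integral_le tauS mh h0 GA' A'E a0).
Qed.

(** The conditional expectation of v at the global time, assembled on each {t_i = n} from the one at
    the fixed time n. This form carries over the A_p condition, which concerns fixed times. *)
Definition glued_avg i (v : T -> R) : T -> R :=
  fun x => if gt i x is Some n then cond P F n v x else 0.

Section one_weight.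
Variable v : T -> R.
Hypotheses (intv : P.-integrable setT (EFin \o v)).

Lemma gmeasurable_glued_avg i : gmeasurable_fun (G i) (glued_avg i v).
Proof.
apply/(gmeasurable_funP _ (sG i)) => B mB.
have sub n : F n (glued_avg i v @^-1` B `&` [set x | gt i x = Some n]).
  rewrite (_ : _ `&` _ = cond P F n v @^-1` B `&` [set x | gt i x = Some n]).
    have [gc _ _] := cond_condexp (sF n) intv.
    apply: salgebraI => //; last exact: global_time_stopping.
    exact: (proj1 (gmeasurable_funP _ (sF n)) gc).
  by apply/seteqP; split => x /= [+ tx]; rewrite /glued_avg tx.
split => //.
rewrite (_ : _ @^-1` _ = (\bigcup_n (glued_avg i v @^-1` B `&` [set x | gt i x = Some n]))
    `|` (if 0 \in B then ~` E i else set0)).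
  apply: measurableU; first by apply: bigcup_measurable => n _; exact: (sF n).2.
  by case: ifP => // _; apply: measurableC; exact: measurable_Eset.
rewrite EsetE//; apply/seteqP; split => x /=.
  case tx : (gt i x) => [n|]; first by left; exists n.
  by rewrite {1}/glued_avg tx => B0; right; rewrite mem_set//= tx; apply.
move=> [[n _ []]//|]; case: ifPn => //; rewrite inE => B0 /=.
by rewrite /glued_avg; case: (gt i x) => // n []; exact.
Qed.

Lemma cond_gt0 n : {ae P, forall x, 0 < v x} ->
  {ae P, forall x, 0 < cond P F n v x}.
Proof.
move=> v0; have [gc ic cE] := cond_condexp (sF n) intv.
have mc := gmeasurable_fun_measurable (sF n) gc.
pose A := cond P F n v @^-1` `]-oo, 0].
have FA : F n A.
  by apply: (proj1 (gmeasurable_funP _ (sF n)) gc); exact: measurable_itv.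
have mA : measurable A by exact: (sF n).2.
exists A; split => //; last first.
  by move=> x /= /negP; rewrite -leNgt /A /= in_itv.
have mv : measurable_fun A (EFin \o v).
  by apply: measurable_funTS; exact: (measurable_int P).
apply: (@measure0_of_integral_le0 _ _ _ P A v) => //.
- exact/measurable_EFinP.
- by apply: filterS v0 => x vx _.
have c0 x : A x -> (0 <= (- cond P F n v x)%:E)%E.
  by rewrite /A /= in_itv /= lee_fin oppr_ge0.
have -> : (\int[P]_(x in A) (v x)%:E = - \int[P]_(x in A) (- cond P F n v x)%:E)%E.
  rewrite -cE// -integral_ge0N//.
  by apply: eq_integral => x _; rewrite -EFinN opprK.
by rewrite oppe_le0; apply: integral_ge0.
Qed.

Lemma glued_avg_gt0 : {ae P, forall x, 0 < v x} ->
  {ae P, forall x, forall i, E i x -> 0 < glued_avg i v x}.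
Proof.
move=> v0; have : {ae P, forall x, forall n, 0 < cond P F n v x}.
  by apply/ae_foralln => n; exact: cond_gt0.
apply: filterS => x cx i; rewrite EsetE//= /glued_avg.
by case: (gt i x).
Qed.

(** Cutting A along the level sets of the global time reduces the claim to the defining identity at
    each fixed n. Here [v'] is an everywhere nonnegative representative of [v]. *)
Lemma glued_avg_integral_le (v' : T -> R) i A : measurable_fun setT v' ->
  (forall x, 0 <= v' x) -> {ae P, forall x, v' x = v x} ->
  G i A -> A `<=` E i -> (forall x, A x -> 0 <= glued_avg i v x) ->
  (\int[P]_(x in A) (v' x)%:E <= \int[P]_(x in A) (glued_avg i v x)%:E)%E.
Proof.
move=> mv' v'0 v'E [mA FA] AE g0.
pose An n := A `&` [set x | gt i x = Some n].
have mAn n : measurable (An n) by exact: (sF n).2 (FA n).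
have AU : A = \bigcup_n An n.
  apply/seteqP; split => x; last by move=> [n _ []].
  move=> Ax; have := AE x Ax; rewrite EsetE//=.
  by case tx : (gt i x) => [n|]// _; exists n.
have tAn : trivIset setT An.
  apply/trivIsetP => n m _ _ nm; apply/seteqP; split => x // -[[_ /= tn] [_ /= tm]].
  by move: nm tm; rewrite tn => /eqP nm [].
have mg := gmeasurable_fun_measurable (sG i) (@gmeasurable_glued_avg i).
have mv := measurable_int P intv.
rewrite AU ge0_integral_bigcup//; last 2 first.
- by apply/measurable_EFinP; exact: measurable_funTS.
- by move=> x _; rewrite lee_fin.
rewrite ge0_integral_bigcup//; last 2 first.
- by apply/measurable_EFinP; exact: measurable_funTS.
- by rewrite -AU => x Ax; rewrite lee_fin; exact: g0.
rewrite le_eqVlt; apply/orP; left; apply/eqP; apply: eq_eseriesr => n _.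
have [gc ic cE] := cond_condexp (sF n) intv.
transitivity (\int[P]_(x in An n) (cond P F n v x)%:E)%E; last first.
  by apply: eq_integral => x; rewrite inE => -[_ tx]; rewrite /glued_avg tx.
rewrite cE//; apply: ae_eq_integral => //.
- by apply/measurable_EFinP; exact: measurable_funTS.
- by apply: measurable_funTS.
- by apply: filterS v'E => x ->.
Qed.

End one_weight.
End glued.
End averages.

(** * Removing the truncation *)

Section comparison_sets.
Context (d : measure_display) (T : measurableType d) (R : realType).
Variable G : set (set T).
Hypothesis sG : sub_salgebra G.

Lemma salgebra_le (g h : T -> R) : gmeasurable_fun G g -> gmeasurable_fun G h ->
  G [set x | g x <= h x].
Proof.
move=> mg mh; rewrite -{1}(salgebra_measurableE sG) -[X in measurable X]setTI.
exact: (@measurable_fun_le _ (g_sigma_algebraType G)).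
Qed.

Lemma salgebra_lt (g h : T -> R) : gmeasurable_fun G g -> gmeasurable_fun G h ->
  G [set x | g x < h x].
Proof.
move=> mg mh.
rewrite (_ : [set x | _] = ~` [set x | h x <= g x]).
  by apply: salgebraC => //; exact: salgebra_le.
by apply/seteqP; split => x /=; rewrite ltNge => /negP.
Qed.

End comparison_sets.

(** A finite L bounds every Y n by (L/w)^(1/p), and this bound passes to the limit before the power
    p is taken. *)
Lemma limn_poweR_le (R : realType) (p w : R) (Y : nat -> R) (L : \bar R) :
  0 < p -> 0 < w -> (forall n, 0 <= Y n) ->
  {homo Y : m n / (m <= n)%N >-> m <= n} ->
  (forall n, ((Y n `^ p * w)%:E <= L)%E) ->
  (limn (fun n => (Y n)%:E) `^ p * w%:E <= L)%E.
Proof.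
move=> p0 w0 Y0 Ynd; case: L => [l||] YL; last 2 first.
- by rewrite leey.
- by have := YL 0%N.
have Yl n : Y n <= (l / w) `^ p^-1.
  have : Y n `^ p <= l / w by rewrite ler_pdivlMr// -lee_fin.
  move=> /(@ge0_ler_powR _ p^-1).
  rewrite -powRrM mulfV ?gt_eqF// powRr1//; apply.
  - by rewrite invr_ge0 ltW.
  - by rewrite nnegrE powR_ge0.
  rewrite nnegrE divr_ge0 ?(ltW w0)//; have := YL 0%N; rewrite lee_fin.
  by apply: le_trans; rewrite mulr_ge0 ?powR_ge0 ?(ltW w0).
have cvgY : cvgn (fun n => (Y n)%:E).
  by apply: ereal_nondecreasing_is_cvgn => m n mn; rewrite lee_fin Ynd.
have l0 : 0 <= l / w.
  rewrite divr_ge0 ?(ltW w0)//; have := YL 0%N; rewrite lee_fin.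
  by apply: le_trans; rewrite mulr_ge0 ?powR_ge0 ?(ltW w0).
have limY : (limn (fun n => (Y n)%:E) <= ((l / w) `^ p^-1)%:E)%E.
  by apply: lime_le => //; apply: nearW => n; rewrite lee_fin.
have lim0 : (0 <= limn (fun n => (Y n)%:E))%E.
  by apply: lime_ge => //; apply: nearW => n; rewrite lee_fin.
have : (limn (fun n => (Y n)%:E) `^ p <= (l / w)%:E)%E.
  have -> : (l / w)%:E = (((l / w) `^ p^-1)%:E `^ p)%E.
    by rewrite poweR_EFin -powRrM mulVf ?gt_eqF// powRr1.
  apply: gt0_ler_poweR => //; first exact: ltW.
  - by rewrite in_itv /= lim0 leey.
  - by rewrite in_itv /= lee_fin powR_ge0 leey.
rewrite -(@lee_pmul2r _ w%:E)// => /le_trans; apply.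
by rewrite -EFinM divfK// gt_eqF.
Qed.

(** * From the truncated estimate to the sparse operator *)

Section sparse_bound.
Context (d : measure_display) (T : measurableType d) (R : realType).
Variables (P : probability T R) (F : nat -> set (set T)) (p K : R).
Variables (w f : T -> R) (tau : nat -> T -> option nat).
Hypotheses (p1 : 1 < p) (fps : filtered_probability_space P F).
Hypotheses (ww : weight P w) (wAp : in_Ap P F p w).
Hypotheses (sp : conditionally_sparse P F tau K) (fL : in_Lpw P p w f).

Let p0 : 0 < p. Proof. exact: lt_trans p1. Qed.
Let tauS : shifted_sequence P F tau. Proof. by case: sp. Qed.
Let K1 : 1 <= K. Proof. by case: sp. Qed.
Let sF n : sub_salgebra (F n).
Proof. by split; [exact: (fps_sigma fps)|exact: (fps_sub fps)]. Qed.

Local Notation G := (global_algebra P F tau).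
Local Notation E := (Eset P F tau).
Local Notation S := (Sset P F tau).
Let sG := sub_salgebra_global_algebra fps tauS.

Let mw : measurable_fun setT w.
Proof. by apply/measurable_EFinP; exact: measurable_int ww.1. Qed.
Let mf : measurable_fun setT f. Proof. exact: fL.1. Qed.
Let maf : measurable_fun setT (fun x => `|f x|). Proof. exact: measurableT_comp. Qed.

(** A representative of w that is positive everywhere, as the pointwise hypotheses of the truncated
    estimate demand. *)
Let w' x := if 0 < w x then w x else 1.
Let s' x := w' x `^ (- (p - 1)^-1).
Let mw' : measurable_fun setT w'.
Proof.
by apply: measurable_fun_ifT => //; exact: measurable_fun_ltr.
Qed.
Let w'0 x : 0 < w' x. Proof. by rewrite /w'; case: ifP. Qed.
Let w'E : {ae P, forall x, w' x = w x}.
Proof. by apply: filterS ww.2 => x wx; rewrite /w' wx. Qed.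
Let ms' : measurable_fun setT s'.
Proof. exact: (measurableT_comp (measurable_powR _) mw'). Qed.
Let s'0 x : 0 <= s' x. Proof. exact: powR_ge0. Qed.
Let s'E : {ae P, forall x, s' x = dual_weight p w x}.
Proof. by apply: filterS w'E => x wx; rewrite /s' /dual_weight wx. Qed.

Let ae_int_lty (v v' : T -> R) : P.-integrable setT (EFin \o v) ->
  measurable_fun setT v' -> {ae P, forall x, v' x = v x} ->
  (\int[P]_x (v' x)%:E < +oo)%E.
Proof.
move=> intv mv' v'E; rewrite (_ : (\int[P]_x _ = \int[P]_x (v x)%:E)%E).
  exact: integrable_lty.
apply: ae_eq_integral => //.
- exact/measurable_EFinP.
- exact: measurable_int intv.
- by apply: filterS v'E => x ->.
Qed.

Let Q := fine (Ap_const P F p w).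
Let QE : Ap_const P F p w = Q%:E.
Proof.
rewrite /Q fineK// ge0_fin_numE; first exact: wAp.2.
apply: le_trans (ereal_sup_ubound _); last by exists 0%N.
exact: Lnorm_ge0.
Qed.

Let a i := local_avg P F tau i (fun y => `|f y|).
Let wi i := glued_avg P F tau i w.
Let si i := glued_avg P F tau i (dual_weight p w).

(** Off a single null set the bound holds at all fixed times at once, hence at the value taken by
    the global time. *)
Let ApQ : {ae P, forall x, forall i, E i x -> wi i x * si i x `^ (p - 1) <= Q}.
Proof.
have : {ae P, forall x, forall n,
    cond P F n w x * cond P F n (dual_weight p w) x `^ (p - 1) <= Q}.
  apply/ae_foralln => n.
  pose g x := (cond P F n w x * cond P F n (dual_weight p w) x `^ (p - 1))%:E.
  have : (Lnorm P +oo%E g <= Q%:E)%E.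
    by rewrite -QE; apply: ereal_sup_ubound; exists n.
  rewrite Lnorm.unlock /= probability_setT lte01 => /ess_supP.
  by apply: filterS => x /=; rewrite lee_fin; apply: le_trans; exact: ler_norm.
apply: filterS => x cx i; rewrite (EsetE fps tauS) /= /wi /si /glued_avg.
by case: (global_time P F tau i x) => // n _; exact: cx.
Qed.

(** Besides the truncation at level k, this set of [G j] imposes the properties known only almost
    everywhere, so that they hold pointwise on it. *)
Let good j k : set T := [set x | 0 <= a j x] `&` [set x | 0 < wi j x] `&`
  [set x | 0 < si j x] `&` [set x | wi j x * si j x `^ (p - 1) <= Q] `&`
  [set x | \sum_(l < j.+1) a l x <= k%:R] `&`
  [set x | a j x * si j x `^ (-1) <= k%:R].

(** Intersecting over all j <= i makes the sets decrease in i: on [Dk k i] no earlier term is cut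
    off, and the truncated sum up to i is the full one, bounded by k. *)
Let Dk (k : nat) i := E i `&` \bigcap_(j in [set j | (j <= i)%N]) good j k.

Let ga i : gmeasurable_fun (G i) (a i).
Proof. by apply: gmeasurable_local_avg => // x. Qed.
Let gwi i : gmeasurable_fun (G i) (wi i).
Proof. by apply: gmeasurable_glued_avg => //; exact: ww.1. Qed.
Let gsi i : gmeasurable_fun (G i) (si i).
Proof. by apply: gmeasurable_glued_avg => //; exact: wAp.1. Qed.

Let Gle i j : (i <= j)%N -> G i `<=` G j.
Proof.
elim: j => [|j IH]; first by rewrite leqn0 => /eqP ->.
rewrite leq_eqVlt => /orP[/eqP->//|]; rewrite ltnS => /IH ij.
by apply: (subset_trans ij); exact: global_algebra_incr.
Qed.

Let Ggood j k : G j (good j k).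
Proof.
have gc (c : R) : gmeasurable_fun (G j) (cst c : T -> R) by exact: measurable_cst.
have gs q : gmeasurable_fun (G j) (fun x => si j x `^ q).
  exact: gmeasurable_powR.
repeat (apply: salgebraI; first exact: sG).
- exact: (salgebra_le (sG j) (gc 0)).
- exact: (salgebra_lt (sG j) (gc 0)).
- exact: (salgebra_lt (sG j) (gc 0)).
- apply: (salgebra_le (sG j) _ (gc Q)).
  by apply: measurable_funM; [exact: gwi|exact: gs].
- apply: (salgebra_le (sG j) _ (gc k%:R)).
  apply: (@measurable_sum _ (g_sigma_algebraType (G j))) => l.
  by apply: (sub_gmeasurable_fun (sG l) (sG j)) => //; apply: Gle; rewrite -ltnS.
- apply: (salgebra_le (sG j) _ (gc k%:R)).
  by apply: measurable_funM; [exact: ga|exact: gs].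
Qed.

Let GDk k i : G i (Dk k i).
Proof.
apply: salgebraI; [exact: sG|exact: global_algebra_Eset|].
by apply: salgebra_bigcap => // j /= ji; exact: (Gle ji).
Qed.

Let Dk_good k i x : Dk k i x -> good i k x.
Proof. by move=> [_ /(_ i)]; apply => /=. Qed.

Let Ele i j : (i <= j)%N -> E j `<=` E i.
Proof.
elim: j => [|j IH]; first by rewrite leqn0 => /eqP ->.
rewrite leq_eqVlt => /orP[/eqP->//|]; rewrite ltnS => /IH ij.
by apply: subset_trans ij; exact: Eset_decr.
Qed.

Let Dk_le k i j : (i <= j)%N -> Dk k j `<=` Dk k i.
Proof.
move=> ij x [Ex gx]; split; first exact: Ele Ex.
by move=> l /= li; apply: gx => /=; exact: leq_trans ij.
Qed.

(** The index n is both the number of terms and the truncation level, so one monotone limit removes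
    both. *)
Let Z n x := partial_sparse (Dk n) a n x.
Let Cst := p * (2 * K * (Q `^ Num.max 1 (p - 1)^-1 * (4 * K) `^ (p + (p - 1)^-1)))
    * (p / (p - 1)).

Let Z_bound n : (\int[P]_x (Z n x `^ p * w' x)%:E <=
  (Cst `^ p)%:E * \int[P]_x (`|f x| `^ p * w' x)%:E)%E.
Proof.
apply: (@partial_sparse_le _ _ _ P p K Q n%:R G (Dk n) S w' _ wi si a) => //.
- by move=> i; exact: global_algebra_incr.
- by move=> i; exact: measurable_Sset.
- move=> i j x ij [_ NE] [Ex _]; apply: NE; exact: (Ele ij).
- move=> i A GA AD; case: sp => _ _ /(_ i) spi.
  by apply: (sparse_measure_le fps tauS K1 spi GA) => x /AD [].
- exact: ae_int_lty ww.1 _ _.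
- exact: ae_int_lty wAp.1 _ _.
- by move=> i x /Dk_good [[[[[]]]]].
- by move=> i x /Dk_good [[[[[]]]]].
- by move=> i x /Dk_good [[[[[]]]]].
- by move=> i x /Dk_good [[[[[]]]]].
- move=> i A GA AD; apply: (glued_avg_integral_le fps tauS ww.1) => //.
  + by move=> x; rewrite ltW.
  + by move=> x /AD [].
  + by move=> x /AD /Dk_good [[[[[_ h] _] _] _] _]; exact: ltW.
- move=> i A GA AD; apply: (glued_avg_integral_le fps tauS wAp.1) => //.
  + by move=> x /AD [].
  + by move=> x /AD /Dk_good [[[[_ h] _] _] _]; exact: ltW.
- move=> i A GA AD; apply: (local_avg_integral_le fps tauS) => //.
  + by move=> x /AD [].
  + by move=> x /AD /Dk_good [[[[[]]]]].
- move=> i x Dx; have [[_ /= h] _] := Dk_good Dx; apply: le_trans h.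
  rewrite /partial_sparse; apply: ler_sum => l _; rewrite /stopped_avg indicE.
  rewrite mem_set ?mulr1//; apply: Dk_le Dx; rewrite -ltnS; exact: ltn_ord.
- move=> i x Dx; have [_ /= h] := Dk_good Dx; apply: le_trans h.
  by rewrite /weighted_avg /stopped_avg indicE mem_set ?mulr1.
Qed.

Let al0 n i x : 0 <= stopped_avg (Dk n) a i x.
Proof.
rewrite /stopped_avg indicE; have [|_] := boolP (x \in _); last by rewrite mulr0.
by rewrite inE mulr1 => /Dk_good [[[[[]]]]].
Qed.
Let Z0 n x : 0 <= Z n x. Proof. exact: sumr_ge0. Qed.

Let Dk_incr k l i : (k <= l)%N -> Dk k i `<=` Dk l i.
Proof.
move=> kl x [Ex gx]; split => // j /= ji.
have [[h1 h2] h3] := gx j ji.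
by split; [split => //|]; apply: le_trans; [exact: h2| |exact: h3|]; rewrite ler_nat.
Qed.

Let al_le k l i x : (k <= l)%N -> stopped_avg (Dk k) a i x <= stopped_avg (Dk l) a i x.
Proof.
move=> kl; rewrite {1}/stopped_avg indicE.
have [|_] := boolP (x \in Dk k i); last by rewrite mulr0.
rewrite inE => Dx; rewrite /stopped_avg indicE mem_set//.
exact: Dk_incr kl _ Dx.
Qed.

Let Z_nd x : {homo Z^~ x : m n / (m <= n)%N >-> m <= n}.
Proof.
apply/nondecreasing_seqP => n; rewrite /Z /partial_sparse big_ord_recr /=.
apply: (@le_trans _ _ (\sum_(i < n) stopped_avg (Dk n.+1) a i x)).
  by apply: ler_sum => i _; exact: al_le.
by rewrite lerDl.
Qed.

Let mZ n : measurable_fun setT (Z n).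
Proof.
apply: measurable_sum => i; apply: measurable_funM.
  exact: (gmeasurable_fun_measurable (sG i)).
by apply: measurable_indic; apply: (sG i).2.
Qed.

Let Zpw n x := (Z n x `^ p * w' x)%:E.
Let mZpw n : measurable_fun setT (Zpw n).
Proof.
apply/measurable_EFinP; apply: measurable_funM => //.
exact: (measurableT_comp (measurable_powR _) (mZ n)).
Qed.
Let Zpw_nd x : {homo Zpw^~ x : m n / (m <= n)%N >-> (m <= n)%E}.
Proof.
move=> m n mn; rewrite lee_fin ler_pM2r// ge0_ler_powR ?nnegrE ?(ltW p0)//.
exact: Z_nd.
Qed.

Let lim_bound : (\int[P]_x limn (Zpw^~ x) <=
  (Cst `^ p)%:E * \int[P]_x (`|f x| `^ p * w' x)%:E)%E.
Proof.
have nn n x : (0 <= Zpw n x)%E by rewrite lee_fin mulr_ge0 ?powR_ge0// ltW.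
rewrite monotone_convergence//.
apply: lime_le; last by apply: nearW => n; exact: Z_bound.
apply: ereal_nondecreasing_is_cvgn => m n mn; apply: ge0_le_integral => //.
by move=> x _; exact: Zpw_nd.
Qed.

Let Y x n := \sum_(i < n) a i x.

Let sparse_opE x : sparse_op P F tau f x = limn (fun n => (Y x n)%:E).
Proof.
rewrite /sparse_op; congr (limn _); apply/funext => n.
by rewrite sumEFin big_mkord.
Qed.

(** At almost every point the truncation only delays the terms: any m of them are restored in full
    once the level is high enough. *)
Let sparse_ae : {ae P, forall x,
  (limn (Zpw^~ x) = `|sparse_op P F tau f x| `^ p * (w x)%:E)%E}.
Proof.
have a0 : {ae P, forall x, forall i, 0 <= a i x}.
  by apply/ae_foralln => i; apply: local_avg_ge0 => // x.
have wi0 := glued_avg_gt0 fps tauS ww.1 ww.2.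
have si0 : {ae P, forall x, forall i, E i x -> 0 < si i x}.
  apply: (glued_avg_gt0 fps tauS wAp.1).
  by apply: filterS ww.2 => x wx; exact: powR_gt0.
have sQ : {ae P, forall x, [/\ forall i, E i x -> 0 < si i x,
    forall i, E i x -> wi i x * si i x `^ (p - 1) <= Q & w' x = w x]}.
  by apply: filterS3 si0 ApQ w'E => x; split.
apply: filterS3 a0 wi0 sQ => x ax wx [sx Qx w'x].
rewrite -w'x sparse_opE.
have Y0 n : 0 <= Y x n by exact: sumr_ge0.
have Ynd : {homo Y x : m n / (m <= n)%N >-> m <= n}.
  by apply/nondecreasing_seqP => n; rewrite /Y big_ord_recr /= lerDl.
have cvgY : cvgn (fun n => (Y x n)%:E).
  by apply: ereal_nondecreasing_is_cvgn => m n mn; rewrite lee_fin Ynd.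
have lim0 : (0 <= limn (fun n => (Y x n)%:E))%E.
  by apply: lime_ge => //; apply: nearW => n; rewrite lee_fin.
have cvgZ : cvgn (Zpw^~ x) by apply: ereal_nondecreasing_is_cvgn; exact: Zpw_nd.
rewrite gee0_abs//; apply/eqP; rewrite eq_le; apply/andP; split.
  apply: lime_le => //; apply: nearW => n; rewrite /Zpw EFinM.
  apply: lee_wpmul2r; first by rewrite lee_fin ltW.
  rewrite -poweR_EFin; apply: gt0_ler_poweR; first exact: ltW.
  - by rewrite in_itv /= lee_fin Z0 leey.
  - by rewrite in_itv /= lim0 leey.
  apply: (@le_trans _ _ (Y x n)%:E).
    rewrite lee_fin; apply: ler_sum => i _; rewrite /stopped_avg indicE.
    by case: (x \in _); rewrite ?mulr1// mulr0.
  by apply: lime_ge => //; near=> m; rewrite lee_fin; apply: Ynd; near: m; exact: nbhs_infty_ge.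
apply: limn_poweR_le => // m.
(* All terms being nonnegative, r dominates every partial sum up to m and every ratio of index below
   m, so a level above r keeps those terms. *)
pose r := Y x m + \sum_(j < m) a j x * si j x `^ (-1).
have as0 j : 0 <= a j x * si j x `^ (-1) by rewrite mulr_ge0 ?powR_ge0.
have r0 : 0 <= r by rewrite addr_ge0// sumr_ge0.
have Dx n i : r <= n%:R -> (i < m)%N -> E i x -> Dk n i x.
  move=> rn im Ex; split => // j /= ji.
  have Ej := Ele ji Ex; have jm : (j < m)%N by exact: leq_ltn_trans im.
  split; [split; [split; [split; [split|]|]|]|] => /=.
  - exact: ax.
  - exact: wx.
  - exact: sx.
  - exact: Qx.
  - apply: le_trans rn; apply: (@le_trans _ _ (Y x m)); first exact: (Ynd j.+1).
    by rewrite lerDl sumr_ge0.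
  - apply: le_trans rn; rewrite /r (bigD1 (Ordinal jm))//= addrCA lerDl.
    by rewrite addr_ge0// sumr_ge0.
have [n rn] : exists n : nat, r <= n%:R.
  by exists (Num.bound r); rewrite ltW// archi_boundP.
(* N must also be at least m, so that [Z N] contains the first m terms. *)
pose N := maxn n m.
have rN : r <= N%:R by apply: (le_trans rn); rewrite ler_nat leq_maxl.
apply: (@le_trans _ _ (Zpw N x)); last first.
  apply: lime_ge => //; near=> l; apply: Zpw_nd; near: l; exact: nbhs_infty_ge.
rewrite lee_fin ler_pM2r// ge0_ler_powR ?nnegrE ?(ltW p0)//.
apply: (@le_trans _ _ (\sum_(i < m) stopped_avg (Dk N) a i x)).
  apply: ler_sum => i _; have [Ex|nE] := pselect (E i x).
    by rewrite /stopped_avg indicE mem_set ?mulr1//; exact: Dx.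
  suff -> : a i x = 0 by [].
  by rewrite /a /local_avg indicE memNset// mulr0.
rewrite /Z /partial_sparse.
rewrite -(big_mkord xpredT (fun i => stopped_avg (Dk N) a i x)).
rewrite -(big_mkord xpredT (fun i => stopped_avg (Dk N) a i x)).
rewrite [leRHS](@big_cat_nat _ _ _ m)//=; last exact: leq_maxr.
by rewrite lerDl sumr_ge0.
Unshelve. all: by end_near. Qed.

Lemma sparse_op_bound :
  (wnorm P p w (sparse_op P F tau f) <=
   (p * (2 * K * (4 * K) `^ (p + (p - 1)^-1)) * (p / (p - 1)))%:E
     * Ap_const P F p w `^ (Num.max 1 (p - 1)^-1)%R
     * wnorm P p w (EFin \o f))%E.
Proof.
have mL : measurable_fun setT (fun x => limn (Zpw^~ x)).
  apply: emeasurable_fun_cvg mZpw _ => x _.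
  by apply: ereal_nondecreasing_is_cvgn; exact: Zpw_nd.
have q0 : 0 < p - 1 by rewrite subr_gt0.
have K0 : 0 < K by exact: lt_le_trans K1.
have Cst0 : 0 <= Cst.
  rewrite /Cst !mulr_ge0 ?powR_ge0 ?invr_ge0 ?(ltW p0) ?(ltW K0) ?(ltW q0)//.
have fE : (\int[P]_x (`|(EFin \o f) x| `^ p * (w x)%:E) =
    \int[P]_x (`|f x| `^ p * w' x)%:E)%E.
  apply: ae_eq_integral => //.
  - rewrite (_ : (fun x => _) = (fun x => (`|f x| `^ p * w x)%:E)); last first.
      by apply/funext => x; rewrite EFinM -poweR_EFin.
    apply/measurable_EFinP; apply: measurable_funM => //.
    exact: (measurableT_comp (measurable_powR _) maf).
  - apply/measurable_EFinP; apply: measurable_funM => //.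
    exact: (measurableT_comp (measurable_powR _) maf).
  - by apply: filterS w'E => x wx _; rewrite wx.
have SE : (\int[P]_x (`|sparse_op P F tau f x| `^ p * (w x)%:E) =
    \int[P]_x limn (Zpw^~ x))%E.
  (* The limit is measurable; completeness of P transfers measurability to the integrand with the
     sparse operator, which agrees with it almost everywhere. *)
  have e : ae_eq P setT (fun x => limn (Zpw^~ x))
      (fun x => `|sparse_op P F tau f x| `^ p * (w x)%:E)%E.
    by apply: filterS sparse_ae => x + _.
  apply: ae_eq_integral => //; last exact: ae_eq_sym.
  exact: (ae_measurable_fun (fps_complete fps) e mL).
rewrite /wnorm SE fE QE poweR_EFin.
set I := (\int[P]_x (`|f x| `^ p * w' x)%:E)%E.
have I0 : (0 <= I)%E.
  by apply: integral_ge0 => x _; rewrite lee_fin mulr_ge0 ?powR_ge0// ltW.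
apply: (@le_trans _ _ (((Cst `^ p)%:E * I) `^ p^-1)%E).
  apply: gt0_ler_poweR; [by rewrite invr_ge0 ltW| | |exact: lim_bound].
  - rewrite in_itv /= leey andbT; apply: integral_ge0 => x _; apply: lime_ge.
      by apply: ereal_nondecreasing_is_cvgn; exact: Zpw_nd.
    by apply: nearW => n; rewrite lee_fin mulr_ge0 ?powR_ge0// ltW.
  - by rewrite in_itv /= leey andbT mule_ge0// lee_fin powR_ge0.
rewrite poweRM ?lee_fin ?powR_ge0// poweR_EFin -powRrM mulfV ?gt_eqF//.
rewrite powRr1// -EFinM le_eqVlt; apply/orP; left; apply/eqP.
by congr (_%:E * _)%E; rewrite /Cst; ring.
Qed.

End sparse_bound.

Theorem theorem1p3 (R : realType) (p K : R) (hp : 1 < p) :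
  exists C : R,
    forall (d : measure_display) (T : measurableType d) (P : probability T R)
      (F : nat -> set (set T)) (w : T -> R) (tau : nat -> T -> option nat)
      (f : T -> R),
      filtered_probability_space P F ->
      weight P w -> in_Ap P F p w ->
      conditionally_sparse P F tau K ->
      in_Lpw P p w f ->
      (wnorm P p w (sparse_op P F tau f) <=
       C%:E * Ap_const P F p w `^ (Num.max 1 (p - 1)^-1)%R
            * wnorm P p w (EFin \o f))%E.
Proof.
(* The first p comes from telescoping, 2K from passing to the controlled part of the sparse sets,
   the power of 4K from [Ap_product_le], and p/(p-1) from Doob's inequality. *)
exists (p * (2 * K * (4 * K) `^ (p + (p - 1)^-1)) * (p / (p - 1))).
by move=> d T P F w tau f fps ww wAp sp fL; exact: sparse_op_bound.
Qed.
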